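(* Let $\alpha\in(\tfrac12,1)$, $0<\eta_0\le\frac1{2\lambda_\Sigma}$, $\eta_t=\eta_0t^{-\alpha}$, and let $X(\Lambda^\star)$ be the unique solution of the Lyapunov equation $\eta_0(AX+XA^\top)=\Lambda^\star$. Then, as $T\to\infty$, $$\bar\Lambda_T-\Lambda^\star-T^{\alpha-1}X(\Lambda^\star)=O(T^{2\alpha-2})\,\Gamma$$ in the matrix big-$O$ sense.
   Context: $\mathcal S$ is a finite state space, $\gamma\in[0,1)$, $P(\cdot\mid s)$ a Markov transition kernel on $\mathcal S$ with stationary distribution $\mu$, $r:\mathcal S\to[0,1]$ the expected reward, and $\phi:\mathcal S\to\mathbb R^d$ a feature map with $\|\phi(s)\|_2\le1$. $A=\mathbb E_{s\sim\mu,s'\sim P(\cdot\mid s)}[\phi(s)(\phi(s)-\gamma\phi(s'))^\top]$, $b=\mathbb E_{s\sim\mu}[\phi(s)r(s)]$, $\Sigma=\mathbb E_{s\sim\mu}[\phi(s)\phi(s)^\top]$, $\lambda_0=\lambda_{\min}(\Sigma)>0$, $\lambda_\Sigma=\lambda_{\max}(\Sigma)$, $\theta^\star=A^{-1}b$. With $s_t\sim\mu$, $s_t'\sim P(\cdot\mid s_t)$, $r_t\in[0,1]$, $\mathbb E[r_t\mid s_t]=r(s_t)$, $A_t=\phi(s_t)(\phi(s_t)-\gamma\phi(s_t'))^\top$, $b_t=r_t\phi(s_t)$: $\Gamma=\mathbb E[(A_t\theta^\star-b_t)(A_t\theta^\star-b_t)^\top]$, $\Lambda^\star=A^{-1}\Gamma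 A^{-\top}$. For $0\le t\le T$, $Q_t=\eta_t\sum_{j=t}^T\prod_{k=t+1}^j(I-\eta_kA)$ (empty product $=I$), $\bar\Lambda_T=\frac1T\sum_{t=1}^TQ_t\Gamma Q_t^\top$. Matrix big-$O$ notation: for matrices $F_T$, a scalar sequence $f_T$ and a fixed positive semidefinite matrix $M$, $F_T=O(f_T)M$ means there is a constant $\tilde C$ independent of $T$ and $M$ with $\|F_T\|\le\tilde Cf_T\|M\|$ and $\mathrm{Tr}(F_T)\le\tilde Cf_T\mathrm{Tr}(M)$ for all $T$. *)

(* Defs.v *)
From HB Require Import structures.
From mathcomp Require Import all_boot all_order all_algebra.
From mathcomp Require Import all_classical all_reals all_analysis.
Set Implicit Arguments. Unset Strict Implicit. Unset Printing Implicit Defensive.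
Import Order.TTheory GRing.Theory Num.Theory.
Local Open Scope ring_scope.

Definition vnorm2 {R : realType} {d : nat} (v : 'cV[R]_d) : R :=
  Num.sqrt (\sum_i v i 0 ^+ 2).

Definition opnorm {R : realType} {d : nat} (M : 'M[R]_d) : R :=
  sup [set vnorm2 (M *m x) | x in [set x : 'cV[R]_d | vnorm2 x <= 1]].

(* smallest / largest eigenvalue (Sigma is real symmetric, so all its
   eigenvalues are real) *)
Definition lam_min {R : realType} {d : nat} (M : 'M[R]_d) : R :=
  inf [set a : R | eigenvalue M a].
Definition lam_max {R : realType} {d : nat} (M : 'M[R]_d) : R :=
  sup [set a : R | eigenvalue M a].

Section TD.
Context {R : realType} {S : finType} {d : nat}.
Variables (gamma : R) (P : S -> S -> R) (mu : S -> R) (phi : S -> 'cV[R]_d).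

Definition Amat_t (s s' : S) : 'M[R]_d := phi s *m (phi s - gamma *: phi s')^T.

Definition Amat : 'M[R]_d := \sum_s \sum_s' (mu s * P s s') *: Amat_t s s'.

Definition bvec (r : S -> R) : 'cV[R]_d := \sum_s (mu s * r s) *: phi s.

Definition Sigma : 'M[R]_d := \sum_s mu s *: (phi s *m (phi s)^T).

Definition theta_star (r : S -> R) : 'cV[R]_d := invmx Amat *m bvec r.

Definition gvec (theta : 'cV[R]_d) (s s' : S) (x : R) : 'cV[R]_d :=
  Amat_t s s' *m theta - x *: phi s.

(* Gamma = E[(A_t theta* - b_t)(A_t theta* - b_t)^T], where s_t ~ mu,
   s_t' ~ P(.|s_t) and r_t ~ nu s_t s_t' (conditional law of the reward) *)
Definition Gamma (r : S -> R) (nu : S -> S -> probability R R) : 'M[R]_d :=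
  \matrix_(i, j) \sum_s \sum_s' (mu s * P s s' *
     fine (\int[nu s s']_x
        (((gvec (theta_star r) s s' x) *m (gvec (theta_star r) s s' x)^T) i j)%:E)).

Definition LamStar (r : S -> R) (nu : S -> S -> probability R R) : 'M[R]_d :=
  invmx Amat *m Gamma r nu *m (invmx Amat)^T.
End TD.

Definition pmean {R : realType} (nu : probability R R) : R :=
  fine (\int[nu]_x x%:E).

(* step sizes eta_t = eta0 t^{-alpha} (used for t >= 1) *)
Definition eta {R : realType} (eta0 alpha : R) (t : nat) : R :=
  eta0 * (t%:R) `^ (- alpha).

Definition Qmat {R : realType} {d : nat} (A : 'M[R]_d) (eta0 alpha : R)
  (T t : nat) : 'M[R]_d :=
  eta eta0 alpha t *:
    \sum_(t <= j < T.+1)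
       \big[mulmx/1%:M]_(t.+1 <= k < j.+1) (1%:M - eta eta0 alpha k *: A).

Definition LamBar {R : realType} {d : nat} (A G : 'M[R]_d) (eta0 alpha : R)
  (T : nat) : 'M[R]_d :=
  (T%:R)^-1 *: \sum_(1 <= t < T.+1)
     (Qmat A eta0 alpha T t *m G *m (Qmat A eta0 alpha T t)^T).

(* Main.v *)
Require Import Defs.
From HB Require Import structures.
From mathcomp Require Import all_boot all_order all_algebra.
From mathcomp Require Import all_classical all_reals all_analysis measurable_realfun.
From mathcomp Require Import ring lra.
Import Order.TTheory GRing.Theory Num.Theory.
Local Open Scope ring_scope.

(** Let x_t = (I - eta_t A) x_{t-1} + eta_t e_t with white noise of covariance G.
    Then T LamBar_T is the covariance S_T of z_T = x_1 + ... + x_T, and the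
    covariances V of x, W of (z, x) and S of z satisfy
      V_t = (I - eta_t A) V_{t-1} (I - eta_t A)^T + eta_t^2 G,
      W_t = W_{t-1} (I - eta_t A)^T + V_t,   S_t = S_{t-1} + W_t + W_t^T - V_t.
    Stationarity of mu makes A coercive, so these recursions contract in Frobenius
    norm.  If A Y + Y A^T = G, this gives V_t = eta_t Y + v_t and W_t = Y A^{-T} + w_t
    with v_t = O(1/t) and w_t = O(t^{alpha-1}).  Solving the recursions of v and w for
    w_{t-1} + w_{t-1}^T shows that S_t - t L - t^alpha X, corrected by
      t^{2 alpha} A^{-1} v_t A^{-T} / eta0^2
        + t^alpha (w_t A^{-T} + A^{-1} w_t^T) / eta0 = O(t^{2 alpha - 1}),
    where X = A^{-1} Y A^{-T} / eta0, has increments O(t^{2 alpha - 2}), which are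
    summed.  The constant is uniform in G because all quantities are linear in G; the
    trace bound follows because |G_ij| <= (G_ii + G_jj) / 2. *)

(** * Growth of scalar sequences, measured by real powers of the index *)

(** Index 0 is excluded because zero raised to a nonzero power is 0, which would force [f 0 = 0]. *)
Definition powO {R : realType} (p : R) (f : nat -> R) : Prop :=
  exists K, forall t, (0 < t)%N -> `|f t| <= K * t%:R `^ p.

Section PowO.
Context {R : realType}.
Implicit Types (p q : R) (f g : nat -> R).

Lemma eq_powO p f g : (forall t, (0 < t)%N -> f t = g t) -> powO p g -> powO p f.
Proof. by move=> fg [K gK]; exists K => t t0; rewrite fg// gK. Qed.

Lemma powR_natD (t : nat) p q : (0 < t)%N ->
  t%:R `^ (p + q) = t%:R `^ p * t%:R `^ q :> R.
Proof. by move=> t0; rewrite powRD// pnatr_eq0 -lt0n t0 implybT. Qed.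

Lemma powR_nat_sub1 (t : nat) p : (0 < t)%N ->
  t%:R `^ (p - 1) = t%:R `^ p / t%:R :> R.
Proof. by move=> t0; rewrite powR_natD// powR_inv1. Qed.

Lemma powO_powR p : powO p (fun t => t%:R `^ p).
Proof. by exists 1 => t _; rewrite mul1r ger0_norm ?powR_ge0. Qed.

Lemma powOM p q f g : powO p f -> powO q g -> powO (p + q) (fun t => f t * g t).
Proof.
move=> [K fK] [L gL]; exists (K * L) => t t0.
by rewrite normrM powR_natD// mulrACA ler_pM ?fK ?gL.
Qed.

Lemma powOD p f g : powO p f -> powO p g -> powO p (fun t => f t + g t).
Proof.
move=> [K fK] [L gL]; exists (K + L) => t t0.
by rewrite mulrDl (le_trans (ler_normD _ _))// lerD ?fK ?gL.
Qed.

Lemma powON p f : powO p f -> powO p (fun t => - f t).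
Proof. by move=> [K fK]; exists K => t t0; rewrite normrN fK. Qed.

Lemma powO_cst (c : R) : powO 0 (fun=> c).
Proof. by exists `|c| => t _; rewrite powRr0 mulr1. Qed.

Lemma powOMl (c : R) p f : powO p f -> powO p (fun t => c * f t).
Proof. by move=> fp; rewrite -[p]add0r; apply: powOM => //; exact: powO_cst. Qed.

Lemma powO_sum (I : finType) p (F : I -> nat -> R) :
  (forall i, powO p (F i)) -> powO p (fun t => \sum_i F i t).
Proof.
move=> Fp; have [K FK] := choice Fp; exists (\sum_i K i) => t t0.
rewrite mulr_suml (le_trans (ler_norm_sum _ _ _))// ler_sum// => i _.
exact: FK.
Qed.

Lemma powO_le p q f : p <= q -> powO p f -> powO q f.
Proof.
move=> pq [K fK]; exists `|K| => t t0.
apply: le_trans (fK t t0) _; apply: (@le_trans _ _ (`|K| * t%:R `^ p)).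
  by rewrite ler_wpM2r ?powR_ge0// ler_norm.
by rewrite ler_wpM2l// ler_powR// ler1n.
Qed.

(** Finitely many early terms only enlarge the constant, by the sum of their ratios to s^p. *)
Lemma powO_eventually p f (t0 : nat) (K : R) :
  (forall t, (t0 <= t)%N -> (0 < t)%N -> `|f t| <= K * t%:R `^ p) -> powO p f.
Proof.
move=> fK; exists (`|K| + \sum_(s < t0) `|f s| / s%:R `^ p) => t tp.
have tpos : 0 < t%:R `^ p :> R by rewrite powR_gt0// ltr0n.
have term_ge0 (s : nat) : 0 <= `|f s| / s%:R `^ p :> R by rewrite divr_ge0// powR_ge0.
have [le_t0|lt_t0] := leqP t0 t.
  apply: le_trans (fK _ le_t0 tp) _; rewrite ler_pM2r//.
  apply: le_trans (ler_norm _) _; rewrite lerDl; apply: sumr_ge0 => s _; exact: term_ge0.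
rewrite -ler_pdivrMr// (bigD1 (Ordinal lt_t0))//=.
rewrite addrCA lerDl addr_ge0//; apply: sumr_ge0 => s _; exact: term_ge0.
Qed.

(** Both bounds come from ln(1 + x) <= x: the upper one at x = -1/t, the lower one at x = 1/(t - 1)
    for the inverse ratio, together with 1/(t - 1) <= 2/t. *)
Lemma ln_pred_bounds (t : nat) : (2 <= t)%N ->
  - (2 / t%:R) <= ln (t.-1%:R / t%:R : R) <= - (1 / t%:R).
Proof.
case: t => [//|[//|s]] _ /=.
have s0 : (0 : R) <= s%:R by [].
have E1 : s.+1%:R = s%:R + 1 :> R by rewrite -natr1.
have E2 : s.+2%:R = s%:R + 2 :> R by rewrite -natr1 E1; ring.
apply/andP; split; last first.
  have -> : s.+1%:R / s.+2%:R = 1 + (- (1 / s.+2%:R)) :> R.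
    by rewrite E1 E2; field; lra.
  apply: le_ln1Dx; rewrite ltrNl opprK E2 ltr_pdivrMr; lra.
have -> : s.+1%:R / s.+2%:R = (1 + 1 / s.+1%:R)^-1 :> R.
  by rewrite E1 E2; field; apply/andP; split; lra.
rewrite lnV ?posrE; last by rewrite addr_gt0// divr_gt0// ltr0n.
rewrite lerN2; apply: (@le_trans _ _ (1 / s.+1%:R)).
  have i0 : 0 < 1 / s.+1%:R :> R by rewrite divr_gt0.
  by apply: le_ln1Dx; rewrite (lt_trans _ i0)// ltrN10.
rewrite E1 E2 -subr_ge0.
have -> : 2 / (s%:R + 2) - 1 / (s%:R + 1) = s%:R / ((s%:R + 1) * (s%:R + 2)) :> R.
  by field; apply/andP; split; lra.
by rewrite divr_ge0// mulr_ge0//; lra.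
Qed.

Lemma norm_expR_sub1 (y : R) : `|expR y - 1| <= `|y| * expR `|y|.
Proof.
have [y0|y0] := leP 0 y.
  rewrite (ger0_norm y0) ger0_norm; last first.
    by rewrite subr_ge0 (le_trans _ (expR_ge1Dx y))// lerDl.
  have := expR_ge1Dx (- y); rewrite expRN => H.
  have e0 := expR_gt0 y.
  have : (1 - y) * expR y <= 1 by rewrite -ler_pdivlMr// mul1r.
  rewrite mulrBl mul1r; lra.
have e1 : expR y <= 1 by rewrite -expR0 ler_expR ltW.
rewrite (ltr0_norm y0) ler0_norm ?subr_le0//.
have := expR_ge1Dx y.
have e2 : 1 <= expR (- y) by rewrite -expR0 ler_expR; lra.
have : - y <= - y * expR (- y) by rewrite ler_peMr//; lra.
lra.
Qed.

Lemma powR_pred (t : nat) p : (2 <= t)%N ->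
  t.-1%:R `^ p = t%:R `^ p * expR (p * ln (t.-1%:R / t%:R)).
Proof.
move=> t2; have t0 : (0 < t)%N by exact: leq_trans t2.
have t10 : (0 < t.-1)%N by rewrite -ltnS prednK.
rewrite ln_div ?posrE ?ltr0n// /powR !gt_eqF ?ltr0n//.
by rewrite -expRD; congr expR; ring.
Qed.

(** With y = p ln((t - 1)/t) the difference is t^p (exp y - 1), and |y| <= 2|p|/t <= |p| for t >=
    2. *)
Lemma powO_diff p : powO (p - 1) (fun t => t.-1%:R `^ p - t%:R `^ p).
Proof.
apply: (@powO_eventually _ _ 2 (`|p| * 2 * expR `|p|)) => t t2 t0.
have tR : (2 : R) <= t%:R by rewrite (ler_nat R 2).
have t0R : (0 : R) < t%:R by rewrite ltr0n.
rewrite powR_pred// -[X in _ - X]mulr1 -mulrBr normrM (ger0_norm (powR_ge0 _ _)).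
apply: le_trans (_ : t%:R `^ p * (`|p| * 2 / t%:R * expR `|p|) <= _); last first.
  by rewrite powR_nat_sub1//; lra.
rewrite ler_wpM2l ?powR_ge0//.
apply: le_trans (norm_expR_sub1 _) _.
have /andP[l1 l2] := ln_pred_bounds t t2.
set l := ln _ in l1 l2 *.
have ll : `|l| <= 2 / t%:R.
  have i0 : 0 < 1 / t%:R :> R by rewrite divr_gt0.
  by rewrite ler_norml l1/=; lra.
have i1 : 2 / t%:R <= 1 :> R by rewrite ler_pdivrMr// mul1r.
rewrite normrM; apply: ler_pM; rewrite ?expR_ge0// ?mulr_ge0//.
  by rewrite -mulrA ler_wpM2l.
by rewrite ler_expR ler_piMr// (le_trans ll).
Qed.

(** For t >= 2 a unit shift changes t^p by a bounded factor; at t = 1 the arbitrary value [f 0] goes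
    into the constant. *)
Lemma powO_pred p f : powO p f -> powO p (fun t => f t.-1).
Proof.
move=> [K fK]; apply: (@powO_eventually _ _ 2 (`|K| * expR (2 * `|p|))) => t t2 t0.
have t10 : (0 < t.-1)%N by rewrite -ltnS prednK.
apply: le_trans (fK _ t10) _; rewrite powR_pred//.
apply: le_trans (_ : `|K| * (t%:R `^ p * expR (2 * `|p|)) <= _); last first.
  by rewrite mulrCA mulrC (mulrC `|K|).
apply: le_trans (_ : `|K| * (t%:R `^ p * expR (p * ln (t.-1%:R / t%:R))) <= _).
  by rewrite ler_wpM2r ?ler_norm// mulr_ge0 ?powR_ge0 ?expR_ge0.
rewrite ler_wpM2l// ler_wpM2l ?powR_ge0// ler_expR.
have tR : (2 : R) <= t%:R by rewrite (ler_nat R 2).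
have t0R : (0 : R) < t%:R by rewrite ltr0n.
apply: le_trans (ler_norm _) _; rewrite normrM mulrC ler_wpM2r//.
have /andP[l1 l2] := ln_pred_bounds t t2.
have i0 : 0 < 1 / t%:R :> R by rewrite divr_gt0.
have i1 : 2 / t%:R <= 1 :> R by rewrite ler_pdivrMr// mul1r.
rewrite ler_norml; lra.
Qed.

(** This lower bound on the discrete derivative of t^p lets a sum of powers be dominated by a
    telescoping sum. *)
Lemma powR_increment_ge p (t : nat) : 0 < p -> (0 < t)%N ->
  p / (1 + p) * t%:R `^ (p - 1) <= t%:R `^ p - t.-1%:R `^ p.
Proof.
move=> p0; case: t => [//|[_|t _]].
  by rewrite !powR1 powR0 ?gt_eqF// mulr1 subr0 ler_pdivrMr; lra.
set s := t.+2; have s2 : (2 <= s)%N by [].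
have s0 : (0 : R) < s%:R by rewrite ltr0n.
rewrite powR_pred// powR_nat_sub1// -[X in _ <= X - _]mulr1 -mulrBr mulrCA.
rewrite ler_wpM2l ?powR_ge0//.
have /andP[_ l2] := ln_pred_bounds s s2.
set l := ln _ in l2 *.
have y0 : 0 < p / s%:R by rewrite divr_gt0.
have yp : p / s%:R <= p by rewrite ler_pdivrMr// ler_peMr ?ltW// (ltr_nat R 1).
have Hl : p * l <= - (p / s%:R).
  have : p * l <= p * - (1 / s%:R) by rewrite ler_pM2l.
  by rewrite mulrN mulrA mulr1.
apply: (@le_trans _ _ (1 - expR (- (p / s%:R)))); last by rewrite lerB// ler_expR.
set y := p / s%:R in y0 yp *.
have -> : p / (1 + p) / s%:R = y / (1 + p) by rewrite /y; field; apply/andP; split; lra.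
(* For y = p/t in (0, p], 1 - exp(-y) >= y/(1 + y) >= y/(1 + p). *)
rewrite expRN; have e1 := expR_ge1Dx y.
apply: (@le_trans _ _ (y / (1 + y))).
  by rewrite ler_pM2l// lef_pV2 ?posrE; lra.
apply: (@le_trans _ _ (1 - (1 + y)^-1)).
  by rewrite le_eqVlt; apply/orP; left; apply/eqP; field; lra.
by rewrite lerB// lef_pV2 ?posrE; lra.
Qed.

(** The increments K s^p are dominated by those of a multiple of s^(p + 1). Since p + 1 > 0, the
    initial value [f 0] is absorbed as well. *)
Lemma powO_increments p f : -1 < p -> powO p (fun t => f t - f t.-1) -> powO (p + 1) f.
Proof.
move=> p1 [K fK]; set q := p + 1; have q0 : 0 < q by rewrite /q; lra.
pose c := q / (1 + q); have c0 : 0 < c by rewrite divr_gt0//; lra.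
have H t : `|f t| <= `|f 0| + `|K| / c * t%:R `^ q.
  elim: t => [|t IH]; first by rewrite powR0 ?gt_eqF// mulr0 addr0.
  have -> : f t.+1 = f t + (f t.+1 - f t) by ring.
  apply: le_trans (ler_normD _ _) _.
  have := fK t.+1 isT; rewrite /= => Hf.
  have := powR_increment_ge q t.+1 q0 isT; rewrite /= -/c (_ : q - 1 = p); last by rewrite /q; ring.
  rewrite -ler_pdivlMl// => Hq.
  have : `|K| * t.+1%:R `^ p <= `|K| * (c^-1 * (t.+1%:R `^ q - t%:R `^ q)) by rewrite ler_wpM2l.
  have : K * t.+1%:R `^ p <= `|K| * t.+1%:R `^ p by rewrite ler_wpM2r ?powR_ge0// ler_norm.
  lra.
exists (`|f 0| + `|K| / c) => t t0; apply: le_trans (H t) _.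
rewrite mulrDl lerD2r ler_peMr// -[leLHS](powRr0 t%:R) ler_powR ?ler1n//; lra.
Qed.

Lemma powR_natN_small (b e : R) : 0 < b -> 0 < e ->
  exists n, forall t, (n <= t)%N -> t%:R `^ (- b) <= e.
Proof.
move=> b0 e0; exists (Num.bound (e^-1 `^ b^-1)) => t nt.
have [->|tn0] := eqVneq t 0%N; first by rewrite powR0 ?oppr_eq0 ?gt_eqF// ltW.
have le_t : e^-1 `^ b^-1 <= t%:R.
  apply: le_trans (_ : (Num.bound (e^-1 `^ b^-1))%:R <= _); last by rewrite ler_nat.
  exact/ltW/archi_boundP/powR_ge0.
rewrite powRN -[leRHS]invrK lef_pV2 ?posrE ?invr_gt0 ?powR_gt0 ?ltr0n ?lt0n//.
have <- : (e^-1 `^ b^-1) `^ b = e^-1.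
  by rewrite -powRrM mulVf ?gt_eqF// powRr1// invr_ge0 ltW.
by rewrite ge0_ler_powR ?nnegrE ?powR_ge0//; exact: ltW.
Qed.

(* The decay rate k t^{-a} of the homogeneous recursion beats the relative
   variation O(1/t) of t^q because a < 1. *)
Lemma powO_contraction (a k q : R) (u : nat -> R) (t0 : nat) (K : R) :
  0 < a < 1 -> 0 < k -> (forall t, 0 <= u t) ->
  (forall t, (t0 <= t)%N -> (0 < t)%N ->
     u t <= (1 - k * t%:R `^ (- a)) * u t.-1 + K * t%:R `^ (q - a)) ->
  powO q u.
Proof.
move=> /andP[a0 a1] k0 u0 uK; have [C HC] := powO_diff q.
pose C' := `|C| + 1.
have C'0 : 0 < C' by rewrite /C' ltr_wpDl.
have [n1 Hn1] := powR_natN_small a k^-1 a0 ltac:(by rewrite invr_gt0).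
have [n2 Hn2] := powR_natN_small (1 - a) (k / (2 * C')) ltac:(lra)
  ltac:(by rewrite divr_gt0// mulr_gt0).
(* Past [n1] the factor 1 - k t^(-a) is nonnegative; past [n2] the relative variation of t^q, at
   most C'/t, is at most half of the contraction rate k t^(-a). *)
pose t1 := (t0 + n1 + n2).+1.
(* The first term of [B] starts the induction at [t1]; the second gives |K| <= B k/2, so the forcing
   uses up the other half of the contraction. *)
pose B := `|u t1| / t1%:R `^ q + 2 * `|K| / k.
have t1q : 0 < t1%:R `^ q :> R by rewrite powR_gt0// ltr0n.
apply: (@powO_eventually _ _ t1 B) => t t1t tp; rewrite ger0_norm//.
have BK : `|K| <= B * k / 2.
  have : 2 * `|K| / k <= B by rewrite /B lerDr divr_ge0// ltW.
  rewrite ler_pdivrMr//; lra.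
have B0 : 0 <= B by rewrite /B addr_ge0// divr_ge0// ?mulr_ge0// ltW.
rewrite -(subnKC t1t) in tp *; elim: (t - t1)%N => [|j IH] in tp *.
  rewrite addn0 /B mulrDl mulfVK ?gt_eqF//.
  by rewrite ger0_norm// lerDl !mulr_ge0// ltW// invr_gt0.
rewrite addnS; set s := (t1 + j).+1; have sp : (0 < s)%N by [].
have {}IH : u s.-1 <= B * s.-1%:R `^ q by exact: IH.
have s_ge n : (n <= t0 + n1 + n2)%N -> (n <= s)%N.
  by move=> h; rewrite /s /t1 addSn; do 2 apply: leqW; exact: (leq_trans h (leq_addr _ _)).
have := uK s (s_ge t0 ltac:(by rewrite -addnA leq_addr)) sp.
have x1 := Hn1 s (s_ge n1 ltac:(by rewrite addnAC leq_addl)).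
have x2 := Hn2 s (s_ge n2 ltac:(by rewrite leq_addl)).
have := HC s sp; rewrite powR_nat_sub1// powR_natD//.
have sR : (0 : R) < s%:R by rewrite ltr0n.
have {}x2 : C' / s%:R <= k / 2 * s%:R `^ (- a).
  have aa : s%:R `^ a * s%:R `^ (- a) = 1 :> R.
    by rewrite -powR_natD// subrr powRr0.
  have -> : C' / s%:R = C' * (s%:R `^ a / s%:R) * s%:R `^ (- a).
    transitivity (C' / s%:R * (s%:R `^ a * s%:R `^ (- a))); first by rewrite aa mulr1.
    by move: (s%:R `^ a) (s%:R `^ (- a)) => x y; ring.
  rewrite ler_wpM2r ?powR_ge0// -ler_pdivlMl//.
  by move: x2; rewrite opprB powR_nat_sub1// invfM; congr (_ <= _); ring.
set m := s%:R `^ q; set x := s%:R `^ (- a) in x1 x2 *.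
have m0 : 0 <= m by exact: powR_ge0.
have x0 : 0 <= x by exact: powR_ge0.
set z := s%:R^-1 in x2 *; have z0 : 0 < z by rewrite invr_gt0.
rewrite ler_norml => /andP[_ Hm] Hu.
have kx1 : 0 <= 1 - k * x by rewrite subr_ge0 -ler_pdivlMl ?mulr1.
have {}Hm : s.-1%:R `^ q <= m * (1 + k / 2 * x).
  have : C * (m * z) <= m * (C' * z).
    by rewrite mulrCA ler_wpM2l// ler_pM2r// /C'; have := ler_norm C; lra.
  have : m * (C' * z) <= m * (k / 2 * x) by rewrite ler_wpM2l.
  lra.
have {}IH : u s.-1 <= B * (m * (1 + k / 2 * x)).
  by apply: le_trans IH _; rewrite ler_wpM2l.
apply: le_trans Hu _.
have H1 : (1 - k * x) * u s.-1 <= (1 - k * x) * (B * (m * (1 + k / 2 * x))).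
  by rewrite ler_wpM2l.
have H2 : K * (m * x) <= B * k / 2 * (m * x).
  by rewrite ler_wpM2r ?mulr_ge0// (le_trans (ler_norm _)).
apply: le_trans (lerD H1 H2) _.
(* This is the remaining slack: with y = k x, (1 - y)(1 + y/2) + y/2 = 1 - y^2/2. *)
have : 0 <= B * m * (k / 2 * x * (k * x)).
  by rewrite !mulr_ge0// ?divr_ge0// ltW.
rewrite -subr_ge0 => H3; rewrite -subr_ge0.
by apply: le_trans H3 _; rewrite le_eqVlt; apply/orP; left; apply/eqP; field.
Qed.
End PowO.

(** * Frobenius norms, coercive matrices and the Lyapunov equation *)

(** By Lagrange's identity, twice the gap is the double sum of (a_i b_j - a_j b_i)^2. *)
Lemma cauchy_schwarz_sum {R : realType} (I : finType) (a b : I -> R) :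
  (\sum_i a i * b i) ^+ 2 <= (\sum_i a i ^+ 2) * (\sum_i b i ^+ 2).
Proof.
have -> : (\sum_i a i * b i) ^+ 2 = \sum_i \sum_j (a i * b i) * (a j * b j).
  by rewrite expr2 mulr_suml; apply: eq_bigr => i _; rewrite mulr_sumr.
have E : (\sum_i a i ^+ 2) * (\sum_i b i ^+ 2) =
    \sum_i \sum_j (a i ^+ 2 * b j ^+ 2).
  by rewrite mulr_suml; apply: eq_bigr => i _; rewrite mulr_sumr.
have E' : (\sum_i a i ^+ 2) * (\sum_i b i ^+ 2) =
    \sum_i \sum_j (a j ^+ 2 * b i ^+ 2) by rewrite E exchange_big.
rewrite -(@ler_pM2l _ 2)// [leRHS]mulr_natl mulr2n [X in _ <= X + _]E E' -big_split/=.
rewrite mulr_sumr; apply: ler_sum => i _; rewrite -big_split mulr_sumr.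
apply: ler_sum => j _ /=; have := sqr_ge0 (a i * b j - a j * b i); nra.
Qed.

(** This is the squared Frobenius norm, which keeps the estimates polynomial in the entries. *)
Definition frob {R : realType} {m n} (M : 'M[R]_(m, n)) : R :=
  \sum_i \sum_j M i j ^+ 2.

(** [A] need not be symmetric: the condition bounds its symmetric part from below. *)
Definition coercive {R : realType} {d} (A : 'M[R]_d) (c : R) : Prop :=
  forall x : 'I_d -> R, c * (\sum_i x i ^+ 2) <= \sum_i \sum_k x i * A i k * x k.

Section Frobenius.
Context {R : realType}.

Lemma frob_ge0 m n (M : 'M[R]_(m, n)) : 0 <= frob M.
Proof. by apply: sumr_ge0 => i _; apply: sumr_ge0 => j _; exact: sqr_ge0. Qed.

Lemma frob_tr m n (M : 'M[R]_(m, n)) : frob M^T = frob M.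
Proof.
rewrite /frob exchange_big; apply: eq_bigr => i _; apply: eq_bigr => j _.
by rewrite mxE.
Qed.

Lemma sqr_le_frob m n (M : 'M[R]_(m, n)) i j : M i j ^+ 2 <= frob M.
Proof.
rewrite /frob (bigD1 i)//= (bigD1 j)//= -addrA lerDl addr_ge0//.
  by apply: sumr_ge0 => k _; exact: sqr_ge0.
by apply: sumr_ge0 => k _; apply: sumr_ge0 => l _; exact: sqr_ge0.
Qed.

Lemma frob_mulmx m n p (A : 'M[R]_(m, n)) (M : 'M[R]_(n, p)) :
  frob (A *m M) <= frob A * frob M.
Proof.
rewrite -(frob_tr _ _ M) /frob mulr_suml; apply: ler_sum => i _; rewrite mulr_sumr.
apply: ler_sum => j _; rewrite mxE; apply: le_trans (cauchy_schwarz_sum _ _ _) _.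
rewrite le_eqVlt; apply/orP; left; apply/eqP; congr (_ * _).
by apply: eq_bigr => k _; rewrite mxE.
Qed.

(** Young's inequality with a free weight, later tuned to the contraction rate. *)
Lemma frobD_le m n (M N : 'M[R]_(m, n)) (e : R) : 0 < e ->
  frob (M + N) <= (1 + e) * frob M + (1 + e^-1) * frob N.
Proof.
move=> e0; rewrite /frob !mulr_sumr -big_split; apply: ler_sum => i _ /=.
rewrite !mulr_sumr -big_split; apply: ler_sum => j _; rewrite mxE /=.
rewrite -subr_ge0.
have -> : (1 + e) * M i j ^+ 2 + (1 + e^-1) * N i j ^+ 2 - (M i j + N i j) ^+ 2 =
  e^-1 * (e * M i j - N i j) ^+ 2 by field; rewrite gt_eqF.
by rewrite mulr_ge0 ?sqr_ge0 ?invr_ge0 ?ltW.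
Qed.

Lemma coercive_mulmx d n (A : 'M[R]_d) c (M : 'M[R]_(d, n)) : coercive A c ->
  c * frob M <= \sum_i \sum_j M i j * (A *m M) i j.
Proof.
move=> Ac; rewrite /frob exchange_big [leRHS]exchange_big mulr_sumr.
apply: ler_sum => j _; apply: le_trans (Ac (fun i => M i j)) _.
rewrite le_eqVlt; apply/orP; left; apply/eqP; apply: eq_bigr => i _.
by rewrite mxE mulr_sumr; apply: eq_bigr => k _; rewrite mulrA.
Qed.

(** In the expanded square, coercivity controls the cross term and submultiplicativity the term in
    e^2. *)
Lemma frob_gradient_step d n (A : 'M[R]_d) c e (M : 'M[R]_(d, n)) :
  coercive A c -> 0 <= e ->
  frob ((1%:M - e *: A) *m M) <= (1 - 2 * c * e + frob A * e ^+ 2) * frob M.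
Proof.
move=> Ac e0; rewrite mulmxBl mul1mx -scalemxAl.
have -> : frob (M - e *: (A *m M)) =
    frob M - 2 * e * (\sum_i \sum_j M i j * (A *m M) i j) + e ^+ 2 * frob (A *m M).
  rewrite /frob !mulr_sumr -sumrB -big_split; apply: eq_bigr => i _ /=.
  rewrite !mulr_sumr -sumrB -big_split; apply: eq_bigr => j _ /=.
  by rewrite !mxE; move: (\sum_j _) => x; ring.
have H1 := coercive_mulmx _ _ _ _ M Ac.
have H2 : e ^+ 2 * frob (A *m M) <= e ^+ 2 * (frob A * frob M).
  by rewrite ler_wpM2l ?sqr_ge0 ?frob_mulmx.
have H3 : 2 * e * (c * frob M) <= 2 * e * (\sum_i \sum_j M i j * (A *m M) i j).
  by rewrite ler_wpM2l// mulr_ge0.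
apply: le_trans (lerD (lerB (lexx (frob M)) H3) H2) _.
by rewrite le_eqVlt; apply/orP; left; apply/eqP; ring.
Qed.

Lemma coercive_inj d n (A : 'M[R]_d) c (M : 'M[R]_(d, n)) :
  0 < c -> coercive A c -> A *m M = 0 -> M = 0.
Proof.
move=> c0 Ac AM; have := coercive_mulmx _ _ _ _ M Ac.
rewrite AM big1 => [|i _]; last by rewrite big1// => j _; rewrite mxE mulr0.
rewrite pmulr_rle0// => M0; apply/matrixP => i j; rewrite [RHS]mxE.
by apply/eqP; rewrite -sqrf_eq0 eq_le sqr_ge0 andbT (le_trans (sqr_le_frob _ _ M i j)).
Qed.

Lemma coercive_unitmx d (A : 'M[R]_d) c : 0 < c -> coercive A c -> A \in unitmx.
Proof.
move=> c0 Ac; rewrite -unitmx_tr -row_free_unit -kermx_eq0.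
have := mulmx_ker A^T => /(congr1 trmx).
rewrite trmx_mul trmxK trmx0 => /(coercive_inj _ _ _ _ _ c0 Ac) /(congr1 trmx).
by rewrite trmxK trmx0 => ->.
Qed.

(** The equation says that A M is minus the transpose of A M^T, so the pairings of M with A M and of
    M^T with A M^T are opposite, while coercivity bounds both below by c times [frob M]. *)
Lemma coercive_lyapunov_inj d (A : 'M[R]_d) c (M : 'M[R]_d) :
  0 < c -> coercive A c -> A *m M + M *m A^T = 0 -> M = 0.
Proof.
move=> c0 Ac AM; have H1 := coercive_mulmx _ _ _ _ M Ac.
have := coercive_mulmx _ _ _ _ M^T Ac; rewrite frob_tr => H2.
have E : \sum_i \sum_j M^T i j * (A *m M^T) i j =
    - \sum_i \sum_j M i j * (A *m M) i j.
  rewrite exchange_big -sumrN; apply: eq_bigr => i _; rewrite -sumrN.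
  apply: eq_bigr => j _; rewrite -mulrN; congr (_ * _); first by rewrite mxE.
  move/eqP: AM; rewrite addr_eq0 => /eqP AM; rewrite AM [in RHS]mxE opprK.
  by rewrite -[M in RHS]trmxK -trmx_mul [RHS]mxE.
have M0 : c * frob M <= 0 by rewrite E in H2; lra.
rewrite pmulr_rle0// in M0; apply/matrixP => i j; rewrite [RHS]mxE.
by apply/eqP; rewrite -sqrf_eq0 eq_le sqr_ge0 andbT (le_trans (sqr_le_frob _ _ M i j)).
Qed.

(** An injective endomorphism of a finite-dimensional space is invertible. Inverting its matrix
    makes the solution linear in [G], on which the uniformity of the final constant rests. *)
Lemma lyapunov_solution d (A : 'M[R]_d) c : 0 < c -> coercive A c ->
  exists Y : 'M[R]_d -> 'M[R]_d,
    linear Y /\ forall G, A *m Y G + Y G *m A^T = G.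
Proof.
move=> c0 Ac; pose f (Y : 'M[R]_d) := A *m Y + Y *m A^T.
have fl : linear f.
  by move=> k x y; rewrite /f mulmxDr mulmxDl -scalemxAl -scalemxAr scalerDr addrACA.
pose fL : {linear _ -> _} := HB.pack f (GRing.isLinear.Build _ _ _ _ f fl).
have U : lin_mx fL \in unitmx.
  rewrite -row_free_unit -kermx_eq0; apply/rowV0P => v /sub_kermxP.
  rewrite -[v]vec_mxK mul_vec_lin => /eqP; rewrite mxvec_eq0 => /eqP.
  by move/(coercive_lyapunov_inj _ _ _ _ c0 Ac) ->; rewrite linear0.
exists (fun G => vec_mx (mxvec G *m invmx (lin_mx fL))); split=> [k x y|G].
  by rewrite linearP mulmxDl -scalemxAl linearP.
apply: (can_inj mxvecK); rewrite -/(f _) -[f _]/(fL _) -mul_vec_lin vec_mxK.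
by rewrite mulmxKV.
Qed.

End Frobenius.

(** * Entrywise power bounds for matrix sequences, and contracting matrix recursions *)

Definition powOmx {R : realType} {m n} (p : R) (F : nat -> 'M[R]_(m, n)) : Prop :=
  forall i j, powO p (fun t => F t i j).

Section PowOmx.
Context {R : realType}.
Implicit Types (p q : R).

Lemma eq_powOmx m n p (F H : nat -> 'M[R]_(m, n)) :
  (forall t, (0 < t)%N -> F t = H t) -> powOmx p H -> powOmx p F.
Proof. by move=> FH Hp i j; apply: eq_powO (Hp i j) => t t0; rewrite FH. Qed.

Lemma powOmx_cst m n (M : 'M[R]_(m, n)) : powOmx 0 (fun=> M).
Proof. by move=> i j; exact: powO_cst. Qed.

Lemma powOmxD m n p (F H : nat -> 'M[R]_(m, n)) :
  powOmx p F -> powOmx p H -> powOmx p (fun t => F t + H t).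
Proof.
move=> Fp Hp i j; apply: eq_powO (powOD _ _ _ (Fp i j) (Hp i j)) => t _.
by rewrite mxE.
Qed.

Lemma powOmxN m n p (F : nat -> 'M[R]_(m, n)) :
  powOmx p F -> powOmx p (fun t => - F t).
Proof. by move=> Fp i j; apply: eq_powO (powON _ _ (Fp i j)) => t _; rewrite mxE. Qed.

Lemma powOmxB m n p (F H : nat -> 'M[R]_(m, n)) :
  powOmx p F -> powOmx p H -> powOmx p (fun t => F t - H t).
Proof. by move=> Fp Hp; apply: powOmxD => //; exact: powOmxN. Qed.

Lemma powOmxZ m n p q (f : nat -> R) (F : nat -> 'M[R]_(m, n)) :
  powO p f -> powOmx q F -> powOmx (p + q) (fun t => f t *: F t).
Proof.
by move=> fp Fq i j; apply: eq_powO (powOM _ _ _ _ fp (Fq i j)) => t _; rewrite mxE.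
Qed.

Lemma powOmx_tr m n p (F : nat -> 'M[R]_(m, n)) :
  powOmx p F -> powOmx p (fun t => (F t)^T).
Proof. by move=> Fp i j; apply: eq_powO (Fp j i) => t _; rewrite mxE. Qed.

Lemma powOmx_mull m n k p (B : 'M[R]_(k, m)) (F : nat -> 'M[R]_(m, n)) :
  powOmx p F -> powOmx p (fun t => B *m F t).
Proof.
move=> Fp i j.
apply: (eq_powO _ _ (fun t => \sum_l B i l * F t l j)) => [t _|]; first by rewrite mxE.
by apply: powO_sum => l; exact: powOMl.
Qed.

Lemma powOmx_mulr m n k p (B : 'M[R]_(n, k)) (F : nat -> 'M[R]_(m, n)) :
  powOmx p F -> powOmx p (fun t => F t *m B).
Proof.
move=> Fp; apply: (eq_powOmx _ _ _ _ (fun t => (B^T *m (F t)^T)^T)) => [t _|].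
  by rewrite trmx_mul !trmxK.
by apply: powOmx_tr; apply: powOmx_mull; exact: powOmx_tr.
Qed.

Lemma powOmx_le m n p q (F : nat -> 'M[R]_(m, n)) :
  p <= q -> powOmx p F -> powOmx q F.
Proof. by move=> pq Fp i j; exact: powO_le (Fp i j). Qed.

Lemma powOmx_pred m n p (F : nat -> 'M[R]_(m, n)) :
  powOmx p F -> powOmx p (fun t => F t.-1).
Proof. by move=> Fp i j; exact: (powO_pred _ _ (Fp i j)). Qed.

Lemma powOmx_increments m n p (F : nat -> 'M[R]_(m, n)) : -1 < p ->
  powOmx p (fun t => F t - F t.-1) -> powOmx (p + 1) F.
Proof.
move=> p1 Fp i j; apply: (@powO_increments _ p (fun t => F t i j)) => //.
by apply: eq_powO (Fp i j) => t _; rewrite !mxE.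
Qed.

(** The exponent doubles because [frob] is a squared norm. *)
Lemma powO_frob m n p (F : nat -> 'M[R]_(m, n)) :
  powOmx p F -> powO (p + p) (fun t => frob (F t)).
Proof.
move=> Fp; rewrite /frob; apply: powO_sum => i; apply: powO_sum => j.
by apply: (eq_powO _ _ (fun t => F t i j * F t i j)) => //; exact: powOM.
Qed.

Lemma powOmx_frob m n p (F : nat -> 'M[R]_(m, n)) :
  powO (p + p) (fun t => frob (F t)) -> powOmx p F.
Proof.
move=> [K FK] i j; exists (Num.sqrt `|K|) => t t0.
rewrite -(@ler_pXn2r _ 2)// ?nnegrE ?mulr_ge0 ?sqrtr_ge0 ?powR_ge0//.
rewrite exprMn sqr_sqrtr// real_normK ?num_real//.
apply: le_trans (sqr_le_frob _ _ (F t) i j) _.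
apply: le_trans (ler_norm _) _; apply: le_trans (FK t t0) _.
by rewrite powR_natD// -expr2 ler_wpM2r ?sqr_ge0// ler_norm.
Qed.

(** A contraction of rate t^(-a) turns forcing of order p into a solution of order p + a. Only the
    Frobenius bound on [L t] enters, so the map may multiply on one side or on both. *)
Lemma powOmx_contraction m n (a k p : R) (t0 : nat) (E rho : nat -> 'M[R]_(m, n))
    (L : nat -> 'M[R]_(m, n) -> 'M[R]_(m, n)) :
  0 < a < 1 -> 0 < k ->
  (forall t, (t0 <= t)%N -> (0 < t)%N -> forall M,
     frob (L t M) <= (1 - k * t%:R `^ (- a)) * frob M) ->
  (forall t, (0 < t)%N -> E t = L t (E t.-1) + rho t) ->
  powOmx p rho -> powOmx (p + a) E.
Proof.
move=> aP k0 HL HE Hrho; apply: powOmx_frob.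
have [K HK] := powO_frob _ _ _ _ Hrho.
apply: (@powO_contraction _ a (k / 2) _ _ t0 ((1 + 2 / k) * `|K|)) => //.
- by rewrite divr_gt0.
- by move=> t; exact: frob_ge0.
move=> t tt0 tp; have := HL t tt0 tp (E t.-1); have := HK t tp.
rewrite (HE t tp) (ger0_norm (frob_ge0 _ _ _)).
set x := t%:R `^ (- a); set y := frob (rho t); set z := frob (E t.-1).
have /andP[a0 a1] := aP.
have x0 : 0 < x by rewrite powR_gt0// ltr0n.
have x1 : x <= 1 by rewrite -(powRr0 t%:R) ler_powR ?ler1n// oppr_le0 ltW.
have z0 : 0 <= z := frob_ge0 _ _ _.
have y0 : 0 <= y := frob_ge0 _ _ _.
move=> Hy Hz.
(* As Young weight, half of the contraction rate leaves rate k/2 and costs the squared forcing a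
   factor of order t^a. *)
have e0 : 0 < k / 2 * x by rewrite mulr_gt0// divr_gt0.
apply: le_trans (frobD_le _ _ _ _ (k / 2 * x) e0) _.
apply: lerD.
  apply: (@le_trans _ _ ((1 + k / 2 * x) * ((1 - k * x) * z))).
    by rewrite ler_wpM2l// addr_ge0// ltW.
  rewrite mulrA ler_wpM2r// -subr_ge0.
  have -> : 1 - k / 2 * x - (1 + k / 2 * x) * (1 - k * x) = k / 2 * x * (k * x) by field.
  by rewrite mulr_ge0// ltW// mulr_gt0.
have -> : p + a + (p + a) - a = p + p + a by ring.
rewrite powR_natD//; have -> : t%:R `^ a = x^-1 by rewrite /x powRN invrK.
apply: (@le_trans _ _ ((1 + 2 / k) * x^-1 * y)).
  rewrite ler_wpM2r// mulrDl mul1r.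
  have -> : (k / 2 * x)^-1 = 2 / k * x^-1 by field; rewrite !gt_eqF.
  by rewrite lerD2r invf_ge1.
have -> : (1 + 2 / k) * `|K| * (t%:R `^ (p + p) * x^-1) =
  (1 + 2 / k) * x^-1 * (`|K| * t%:R `^ (p + p)) by move: (t%:R `^ (p + p)) x^-1; move=> *; ring.
rewrite ler_wpM2l//; first by rewrite mulr_ge0 ?invr_ge0 ?addr_ge0 ?divr_ge0// ltW.
by apply: le_trans Hy _; rewrite ler_wpM2r ?powR_ge0// ler_norm.
Qed.

(** The factor 1 - 2 c e + [frob A] e^2 is at most 1 - c e once [frob A] e <= c, which holds
    eventually because the steps tend to 0. *)
Lemma coercive_step_contraction d (A : 'M[R]_d) (c a eta0 : R) :
  0 < c -> coercive A c -> 0 < a -> 0 < eta0 ->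
  exists t0, forall t, (t0 <= t)%N -> (0 < t)%N ->
    0 <= 1 - c * eta0 * t%:R `^ (- a) <= 1 /\
    forall n (M : 'M[R]_(d, n)),
    frob ((1%:M - Defs.eta eta0 a t *: A) *m M) <= (1 - c * eta0 * t%:R `^ (- a)) * frob M.
Proof.
(* The summand c^2 makes [b] positive and also yields c e <= 1, so the contraction factor is
   nonnegative. *)
move=> c0 Ac a0 e0; pose b := frob A + c ^+ 2.
have b0 : 0 < b by rewrite ltr_wpDl ?frob_ge0// exprn_gt0.
have [n Hn] := powR_natN_small a (c / b / eta0) a0 ltac:(by rewrite !divr_gt0).
exists n => t nt t0; have := Hn t nt; rewrite /Defs.eta; set x := t%:R `^ (- a).
rewrite ler_pdivlMr// mulrC ler_pdivlMr// => Hx.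
have x0 : 0 <= x by exact: powR_ge0.
have ex0 : 0 <= eta0 * x by rewrite mulr_ge0// ltW.
have f0 := frob_ge0 _ _ A.
have H1 : frob A * (eta0 * x) <= c by move: Hx; rewrite /b; have := sqr_ge0 c; nra.
split=> [|k M].
  apply/andP; split; last by rewrite gerBl -mulrA mulr_ge0// ltW.
  rewrite subr_ge0 -(@ler_pM2l _ c)// mulr1; move: Hx; rewrite /b; nra.
apply: le_trans (frob_gradient_step _ _ _ _ _ M Ac ex0) _.
rewrite ler_wpM2r ?frob_ge0// expr2 (mulrA (frob A)).
have := ler_wpM2r ex0 H1; lra.
Qed.

End PowOmx.

(* Covariances of the linear recursion x_t = (I - eta_t A) x_{t-1} + eta_t e_t
   driven by noise of covariance G, of its partial sums z_T = x_1 + ... + x_T,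
   and the cross covariance of z_T and x_T; the first one below is the weight of
   e_t in x_T, and Qmat is its weight in z_T. *)
Section Covariances.
Context {R : realType} {d : nat}.
Variables (A G : 'M[R]_d) (eta0 alpha : R).
Local Notation e := (Defs.eta eta0 alpha).
Local Notation Q := (Qmat A eta0 alpha).

HB.instance Definition _ := Monoid.isLaw.Build 'M[R]_d 1%:M (@mulmx R d d d)
  (@mulmxA R d d d d) (@mul1mx R d d) (@mulmx1 R d d).

Definition weight (T t : nat) : 'M[R]_d :=
  e t *: \big[mulmx/1%:M]_(t.+1 <= k < T.+1) (1%:M - e k *: A).

Definition covx (T : nat) : 'M[R]_d :=
  \sum_(1 <= t < T.+1) weight T t *m G *m (weight T t)^T.

Definition covzx (T : nat) : 'M[R]_d :=
  \sum_(1 <= t < T.+1) Q T t *m G *m (weight T t)^T.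

Definition covz (T : nat) : 'M[R]_d :=
  \sum_(1 <= t < T.+1) Q T t *m G *m (Q T t)^T.

Lemma weight_diag T : weight T T = (e T)%:M.
Proof. by rewrite /weight big_geq// scalemx1. Qed.

(** The last factor splits off on the right; it moves to the left because all factors are
    polynomials in [A] and commute. *)
Lemma weightS T t : (t <= T)%N ->
  weight T.+1 t = (1%:M - e T.+1 *: A) *m weight T t.
Proof.
move=> tT; rewrite /weight big_nat_recr//= -scalemxAr; congr (_ *: _).
have comm x y : (1%:M - x *: A) *m (1%:M - y *: A) = (1%:M - y *: A) *m (1%:M - x *: A).
  rewrite !(mulmxBl, mulmxBr, mul1mx, mulmx1) -!scalemxAl -!scalemxAr.
  by move: (A *m A) 1%:M => AA I; apply/matrixP => i j; rewrite !mxE; ring.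
elim/big_ind: _ => [|M N HM HN|k _]; first by rewrite mul1mx mulmx1.
  by rewrite -mulmxA HN mulmxA HM mulmxA.
exact: comm.
Qed.

Lemma QmatS T t : (t <= T.+1)%N -> Q T.+1 t = Q T t + weight T.+1 t.
Proof. by move=> tT; rewrite /Qmat big_nat_recr//= scalerDr. Qed.

(** This empty sum lets sums over t <= T run up to T + 1 when consecutive horizons are compared. *)
Lemma Qmat_small T : Q T T.+1 = 0.
Proof. by rewrite /Qmat big_geq// scaler0. Qed.

Lemma covxS T : covx T.+1 =
  (1%:M - e T.+1 *: A) *m covx T *m (1%:M - e T.+1 *: A)^T + e T.+1 ^+ 2 *: G.
Proof.
rewrite /covx big_nat_recr//= weight_diag tr_scalar_mx mul_scalar_mx mul_mx_scalar.
rewrite scalerA -expr2 mulmx_sumr mulmx_suml; congr (_ + _).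
rewrite !big_nat; apply: eq_bigr => t /andP[_ tT].
by rewrite weightS// trmx_mul !mulmxA.
Qed.

Lemma covzxS T : covzx T.+1 = covzx T *m (1%:M - e T.+1 *: A)^T + covx T.+1.
Proof.
have -> : covzx T.+1 =
    \sum_(1 <= t < T.+2) Q T t *m G *m (weight T.+1 t)^T + covx T.+1.
  rewrite /covzx /covx -big_split !big_nat; apply: eq_bigr => t /andP[_ tT] /=.
  by rewrite QmatS// !mulmxDl.
congr (_ + _); rewrite big_nat_recr//= Qmat_small !mul0mx addr0 mulmx_suml.
rewrite !big_nat; apply: eq_bigr => t /andP[_ tT].
by rewrite weightS// trmx_mul !mulmxA.
Qed.

(** Expanding with [QmatS], [covzx] and its transpose both contain the term quadratic in [weight],
    so one copy, [covx], is subtracted. *)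
Lemma covzS T : G^T = G ->
  covz T.+1 = covz T + covzx T.+1 + (covzx T.+1)^T - covx T.+1.
Proof.
move=> GT; apply/eqP; rewrite eq_sym -subr_eq0; apply/eqP.
have -> : covz T = \sum_(1 <= t < T.+2) Q T t *m G *m (Q T t)^T.
  by rewrite big_nat_recr//= Qmat_small !mul0mx addr0.
have -> : (covzx T.+1)^T = \sum_(1 <= t < T.+2) weight T.+1 t *m G *m (Q T.+1 t)^T.
  rewrite /covzx (raddf_sum (@trmx R d d)); apply: eq_bigr => t _ /=.
  by rewrite !trmx_mul trmxK GT mulmxA.
rewrite /covz /covzx /covx -!(big_split, sumrN)/= big_nat big1// => t /andP[_ tT].
rewrite QmatS// !(raddfD (@trmx R d d))/= !(mulmxDl, mulmxDr).
set a := _ *m _ *m _; set b := _ *m _ *m _; set f := _ *m _ *m _; set g := _ *m _ *m _.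
by apply/matrixP => i j; rewrite !mxE; ring.
Qed.

Lemma covx_sym T : G^T = G -> (covx T)^T = covx T.
Proof.
move=> GT; rewrite /covx (raddf_sum (@trmx R d d)); apply: eq_bigr => t _ /=.
by rewrite !trmx_mul trmxK GT mulmxA.
Qed.

End Covariances.

(** * Asymptotic expansion of the covariances for a fixed symmetric [G] *)

Section Asymptotics.
Context {R : realType} {d : nat}.
Variables (A G Y : 'M[R]_d) (c eta0 alpha : R).
Hypotheses (c_gt0 : 0 < c) (A_coercive : coercive A c).
Hypotheses (eta0_gt0 : 0 < eta0) (alpha_bounds : 1 / 2 < alpha < 1).
Hypotheses (G_sym : G^T = G) (Y_lyapunov : A *m Y + Y *m A^T = G).

Local Notation e := (Defs.eta eta0 alpha).
Local Notation B := (invmx A).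
Local Notation h := (fun t : nat => t%:R `^ alpha : R).
Let L := B *m G *m B^T.
Let X := eta0^-1 *: (B *m Y *m B^T).
Let trD (M N : 'M[R]_d) : (M + N)^T = M^T + N^T. Proof. exact: raddfD. Qed.
Let trB (M N : 'M[R]_d) : (M - N)^T = M^T - N^T. Proof. exact: raddfB. Qed.
Let trZ (s : R) (M : 'M[R]_d) : (s *: M)^T = s *: M^T. Proof. exact: linearZ. Qed.

Let A_unit : A \in unitmx.
Proof. exact: coercive_unitmx c_gt0 A_coercive. Qed.

Let BtAt : B^T *m A^T = 1%:M.
Proof. by rewrite -trmx_mul mulmxV// trmx1. Qed.

Let AtBt : A^T *m B^T = 1%:M.
Proof. by rewrite -trmx_mul mulVmx// trmx1. Qed.

(** Since [G] is symmetric, the transpose of [Y] solves the same equation, whose solution is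
    unique. *)
Lemma lyapunov_sym : Y^T = Y.
Proof.
apply/eqP; rewrite -subr_eq0; apply/eqP.
apply: (coercive_lyapunov_inj _ _ _ _ c_gt0 A_coercive).
rewrite mulmxBr mulmxBl addrACA -opprD Y_lyapunov.
have -> : A *m Y^T + Y^T *m A^T = G.
  by rewrite -[RHS]G_sym -Y_lyapunov trD !trmx_mul trmxK addrC.
by rewrite subrr.
Qed.

Lemma congruence_step (s : R) (M : 'M[R]_d) :
  (1%:M - s *: A) *m M *m (1%:M - s *: A)^T =
  M - s *: (A *m M + M *m A^T) + s ^+ 2 *: (A *m M *m A^T).
Proof.
rewrite trB trmx1 trZ !(mulmxBl, mulmxBr, mul1mx, mulmx1) -!(scalemxAl, scalemxAr).
set M1 := A *m M; set M2 := M *m _; set M3 := _ *m _ *m _.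
by apply/matrixP => i j; rewrite !mxE; ring.
Qed.

(* The only terms on the right that are too large to be summed, those in dv and dw
   scaled by s^-2 and s^-1, become discrete derivatives in increment_formula. *)
Lemma pred_cross_formula (s : R) (v1 v0 w0 dv dw rho : 'M[R]_d) :
  s != 0 -> v1^T = v1 -> v1 = v0 + dv ->
  dv = rho + (s * s) *: (A *m v0 *m A^T) - s *: (A *m v0 + v0 *m A^T) ->
  dw = v1 - s *: (w0 *m A^T) ->
  w0 + w0^T =
  (s^-1 ^+ 2) *: (B *m rho *m B^T - B *m dv *m B^T) + v0 +
  s^-1 *: (dv *m B^T + B *m dv - dw *m B^T - B *m dw^T).
Proof.
move=> s0 v1_sym v1E dvE dwE.
(* The recursion of w, solved for the previous value. *)
have K1 : w0 = s^-1 *: (v1 *m B^T - dw *m B^T).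
  rewrite dwE mulmxBl -scalemxAl -mulmxA AtBt mulmx1 opprB addrC subrK.
  by rewrite scalerA mulVf// scale1r.
(* The recursion of v, multiplied by [B] and its transpose and divided by s. *)
have K2 : v0 *m B^T + B *m v0 =
    s^-1 *: (B *m rho *m B^T - B *m dv *m B^T) + s *: v0.
  rewrite dvE mulmxBr mulmxBl mulmxDr mulmxDl -!(scalemxAl, scalemxAr).
  have -> : B *m (A *m v0 *m A^T) *m B^T = v0.
    by rewrite !mulmxA mulVmx// mul1mx -mulmxA AtBt mulmx1.
  have -> : B *m (A *m v0 + v0 *m A^T) *m B^T = v0 *m B^T + B *m v0.
    by rewrite mulmxDr mulmxDl !mulmxA mulVmx// mul1mx -(mulmxA _ A^T) AtBt mulmx1.
  move: (B *m rho *m B^T) (v0 *m B^T + B *m v0) => M1 M2.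
  by apply/matrixP => i j; rewrite !mxE; field.
have K1T : w0^T = s^-1 *: (B *m v1 - B *m dw^T).
  by rewrite K1 trZ trB !trmx_mul !trmxK v1_sym.
rewrite K1T {1}K1 v1E mulmxDl mulmxDr.
have -> : v0 *m B^T =
    s^-1 *: (B *m rho *m B^T - B *m dv *m B^T) + s *: v0 - B *m v0.
  by rewrite -K2 addrK.
move: (B *m rho *m B^T) (B *m dv *m B^T) (dv *m B^T) (B *m dv) (dw *m B^T) (B *m dw^T)
  (B *m v0) => N1 N2 N3 N4 N5 N6 N7.
by apply/matrixP => i j; rewrite !mxE; field.
Qed.

(** This is [Z t - Z t.-1] of the sequel with free variables: [s], [s0] are the steps at t and t -
    1, [h1], [h0] the powers t^alpha and (t - 1)^alpha, and [n] is t - 1. In this form it reduces to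
    an entrywise field identity. *)
Lemma increment_formula (n s s0 h1 h0 : R) (v1 v0 w1 w0 dv dw rho S0 V1 W1 : 'M[R]_d) :
  s * h1 = eta0 -> s != 0 -> v1^T = v1 -> v1 = v0 + dv -> w1 = w0 + dw ->
  V1 = v1 + s *: Y -> W1 = w1 + Y *m B^T ->
  dv = rho + (s * s) *: (A *m v0 *m A^T) - s *: (A *m v0 + v0 *m A^T) ->
  dw = v1 - s *: (w0 *m A^T) ->
  rho = (s0 - s) *: Y + (s ^+ 2 * s0) *: (A *m Y *m A^T) - (s * (s0 - s)) *: G ->
  S0 + W1 + W1^T - V1 - (n + 1) *: L - h1 *: X
    + (eta0^-1 ^+ 2 * h1 ^+ 2) *: (B *m v1 *m B^T)
    + (eta0^-1 * h1) *: (w1 *m B^T + B *m w1^T)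
  - (S0 - n *: L - h0 *: X
    + (eta0^-1 ^+ 2 * h0 ^+ 2) *: (B *m v0 *m B^T)
    + (eta0^-1 * h0) *: (w0 *m B^T + B *m w0^T)) =
  (eta0^-1 * h1 ^+ 2 * (s0 - s) - (h1 - h0)) *: X + (s0 - s) *: Y
  - (eta0^-1 * h1 * (s0 - s)) *: L - dv
  + (eta0^-1 * h1) *: (dv *m B^T + B *m dv) + (dw + dw^T)
  + (eta0^-1 ^+ 2 * ((h1 - h0) * (h1 + h0))) *: (B *m v0 *m B^T)
  + (eta0^-1 * (h1 - h0)) *: (w0 *m B^T + B *m w0^T).
Proof.
move=> sh s_neq0 v1_sym v1E w1E V1E W1E dvE dwE rhoE.
have eta0_neq0 : eta0 != 0 by rewrite gt_eqF.
have h1_neq0 : h1 != 0 by apply: contra_neq eta0_neq0 => h10; rewrite -sh h10 mulr0.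
(* The Lyapunov equation times [B] and its transpose: the constant parts of W and its transpose add
   up to [L]. *)
have LE : Y *m B^T + B *m Y = L.
  rewrite /L -Y_lyapunov mulmxDr mulmxDl !mulmxA mulVmx// mul1mx.
  by rewrite -(mulmxA _ A^T) AtBt mulmx1 addrC.
have rE : B *m rho *m B^T = ((s0 - s) * eta0) *: X +
    (s ^+ 2 * s0) *: Y - (s * (s0 - s)) *: L.
  rewrite rhoE mulmxBr mulmxBl mulmxDr mulmxDl -!(scalemxAl, scalemxAr).
  have -> : B *m (A *m Y *m A^T) *m B^T = Y.
    by rewrite !mulmxA mulVmx// mul1mx -mulmxA AtBt mulmx1.
  by rewrite /X scalerA mulfK.
(* This eliminates [w0] plus its transpose, of order t^(alpha - 1), whose direct summation would
   only give t^alpha. *)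
have := pred_cross_formula _ _ _ _ _ _ _ s_neq0 v1_sym v1E dvE dwE; rewrite rE.
move/eqP; rewrite eq_sym -subr_eq eq_sym => /eqP w0E.
rewrite V1E W1E (trD w1) trmx_mul trmxK lyapunov_sym.
have -> : B *m Y = L - Y *m B^T by rewrite -LE addrC addKr.
rewrite v1E w1E trD !(mulmxDl, mulmxDr).
have ei : eta0^-1 = (s * h1)^-1 by rewrite sh.
move: w0E; rewrite ei -sh.
move: (B *m dv *m B^T) (dv *m B^T) (B *m dv) (dw *m B^T) (B *m dw^T) (w0 *m B^T)
  (B *m w0^T) (B *m v0 *m B^T) (Y *m B^T) L X (w0^T) (dw^T)
  => N1 N2 N3 N4 N5 N6 N7 N8 N9 L0 X0 w0T dwT w0E.
have -> : w0 = w0 + w0T - w0T by rewrite addrK.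
rewrite w0E; apply/matrixP => i j; rewrite !mxE.
by field; rewrite s_neq0 h1_neq0.
Qed.

Let V := covx A G eta0 alpha.
Let W := covzx A G eta0 alpha.
Let v t := V t - e t *: Y.
Let w t := W t - Y *m B^T.
Let de t := e t.-1 - e t.
(** The defect of [e t *: Y] in the recursion of [V]; by the Lyapunov equation the terms in [G]
    cancel up to the step difference [de t]. *)
Let rho t := de t *: Y + (e t ^+ 2 * e t.-1) *: (A *m Y *m A^T) - (e t * de t) *: G.

Let vS t : (0 < t)%N ->
  v t = (1%:M - e t *: A) *m v t.-1 *m (1%:M - e t *: A)^T + rho t.
Proof.
case: t => [//|t] _; rewrite /v /V covxS /= mulmxBr (mulmxBl (_ *m covx _ _ _ _ _)).
rewrite -scalemxAr -scalemxAl.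
rewrite (congruence_step _ Y) Y_lyapunov /rho /de /=.
move: (_ *m covx _ _ _ _ _ *m _) (A *m Y *m A^T) => M1 M2.
by apply/matrixP => i j; rewrite !mxE; ring.
Qed.

(** The constant Y B^T absorbs the part [e t *: Y] of the forcing exactly, leaving [v t]. *)
Let wS t : (0 < t)%N -> w t = w t.-1 *m (1%:M - e t *: A)^T + v t.
Proof.
case: t => [//|t] _; rewrite /w /v /W covzxS -/V /= mulmxBl.
have -> : Y *m B^T *m (1%:M - e t.+1 *: A)^T = Y *m B^T - e t.+1 *: Y.
  by rewrite trB trmx1 trZ mulmxBr mulmx1 -scalemxAr -mulmxA BtAt mulmx1.
move: (_ *m _^T) (V t.+1) (Y *m B^T) => M1 M2 M3.
by apply/matrixP => i j; rewrite !mxE; ring.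
Qed.

Let powO_e : powO (- alpha) e.
Proof. by apply: powOMl; exact: powO_powR. Qed.

Let powO_de : powO (- alpha - 1) de.
Proof.
apply: (eq_powO _ _ (fun t => eta0 * (t.-1%:R `^ (- alpha) - t%:R `^ (- alpha)))).
  by move=> t _; rewrite /de /Defs.eta mulrBr.
by apply: powOMl; exact: powO_diff.
Qed.

Let powO_e' : powO (- alpha) (fun t => e t.-1).
Proof. exact: (powO_pred _ _ powO_e). Qed.

Let powOmxZc p (f : nat -> R) (M : 'M[R]_d) : powO p f -> powOmx p (fun t => f t *: M).
Proof. by move=> fp; rewrite -[p]addr0; apply: powOmxZ => //; exact: powOmx_cst. Qed.

(** Because alpha > 1/2, the cubic term of order -3 alpha stays below order -alpha - 1. *)
Let powO_rho : powOmx (- alpha - 1) rho.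
Proof.
have [a1 a2] := andP alpha_bounds.
rewrite /rho; apply: powOmxB; first apply: powOmxD.
- exact: powOmxZc.
- apply: (@powOmx_le _ _ _ (- alpha + - alpha + - alpha)); first by lra.
  by apply: powOmxZc; apply: powOM => //; exact: powOM.
- apply: (@powOmx_le _ _ _ (- alpha + (- alpha - 1))); first by lra.
  by apply: powOmxZc; apply: powOM.
Qed.

Let alpha01 : 0 < alpha < 1.
Proof. by have [a1 a2] := andP alpha_bounds; apply/andP; split; lra. Qed.

Let powO_v : powOmx (-1) v.
Proof.
have [a0 a1] := andP alpha01.
have [t0 Ht0] := coercive_step_contraction _ _ _ _ _ c_gt0 A_coercive a0 eta0_gt0.
have -> : -1 = - alpha - 1 + alpha :> R by ring.
apply: (@powOmx_contraction _ _ _ alpha (c * eta0) (- alpha - 1) t0 v rho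
  (fun t M => (1%:M - e t *: A) *m M *m (1%:M - e t *: A)^T)) => //.
  exact: mulr_gt0.
move=> t tt0 tp M; have [/andP[k0 k1] Hk] := Ht0 t tt0 tp.
(* The left factor supplies the contraction; the right one, after transposition, is only used as
   nonexpansive. *)
rewrite -mulmxA; apply: le_trans (Hk _ _) _; rewrite ler_wpM2l//.
rewrite -frob_tr trmx_mul trmxK; apply: le_trans (Hk _ _) _.
by rewrite frob_tr ler_piMl ?frob_ge0.
Qed.

Let powO_w : powOmx (alpha - 1) w.
Proof.
have [a0 a1] := andP alpha01.
have [t0 Ht0] := coercive_step_contraction _ _ _ _ _ c_gt0 A_coercive a0 eta0_gt0.
rewrite addrC.
apply: (@powOmx_contraction _ _ _ alpha (c * eta0) (-1) t0 w v
  (fun t M => M *m (1%:M - e t *: A)^T)) => //.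
  exact: mulr_gt0.
move=> t tt0 tp M; have [_ Hk] := Ht0 t tt0 tp.
by rewrite -frob_tr trmx_mul trmxK -(frob_tr _ _ M).
Qed.

Let dv t := v t - v t.-1.
Let dw t := w t - w t.-1.

Let dvE t : (0 < t)%N ->
  dv t = rho t + (e t * e t) *: (A *m v t.-1 *m A^T) - e t *: (A *m v t.-1 + v t.-1 *m A^T).
Proof.
move=> t0; rewrite /dv vS// congruence_step.
set M1 := A *m v t.-1 *m A^T; set M2 := A *m v t.-1 + _; set M3 := v t.-1.
by apply/matrixP => i j; rewrite !mxE; ring.
Qed.

Let dwE t : (0 < t)%N -> dw t = v t - e t *: (w t.-1 *m A^T).
Proof.
move=> t0; rewrite /dw wS// trB trmx1 trZ mulmxBr mulmx1 -scalemxAr.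
set M1 := w t.-1 *m A^T; set M2 := w t.-1.
by apply/matrixP => i j; rewrite !mxE; ring.
Qed.

(** Read off from the recursion, the increments of [v] gain a factor t^(-alpha) over [v] itself. *)
Let powO_dv : powOmx (- alpha - 1) dv.
Proof.
have [a0 a1] := andP alpha01.
have vp := powOmx_pred _ _ _ _ powO_v.
apply: eq_powOmx dvE _; apply: powOmxB; first apply: powOmxD => //.
- apply: (@powOmx_le _ _ _ (- alpha + - alpha + -1)); first by lra.
  apply: powOmxZ; first exact: powOM.
  by apply: powOmx_mulr; apply: powOmx_mull.
- by apply: powOmxZ => //; apply: powOmxD; [exact: powOmx_mull|exact: powOmx_mulr].
Qed.

Let powO_dw : powOmx (-1) dw.
Proof.
have [a0 a1] := andP alpha01.
have wp := powOmx_pred _ _ _ _ powO_w.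
apply: eq_powOmx dwE _; apply: powOmxB => //.
apply: (@powOmx_le _ _ _ (- alpha + (alpha - 1))); first by lra.
by apply: powOmxZ => //; exact: powOmx_mulr.
Qed.

Let eh t : (0 < t)%N -> e t * h t = eta0.
Proof. by move=> t0; rewrite /Defs.eta -mulrA -powR_natD// addNr powRr0 mulr1. Qed.

Let e_neq0 t : (0 < t)%N -> e t != 0.
Proof.
by move=> t0; rewrite gt_eqF// /Defs.eta mulr_gt0// powR_gt0// ltr0n.
Qed.

Let v_sym t : (v t)^T = v t.
Proof. by rewrite /v trB trZ lyapunov_sym /V covx_sym. Qed.

Let S := covz A G eta0 alpha.
Let D t := S t - t%:R *: L - h t *: X.
Let Z t := D t + (eta0^-1 ^+ 2 * h t ^+ 2) *: (B *m v t *m B^T) +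
  (eta0^-1 * h t) *: (w t *m B^T + B *m (w t)^T).

Let ZS t : (0 < t)%N ->
  Z t - Z t.-1 =
  (eta0^-1 * h t ^+ 2 * de t - (h t - h t.-1)) *: X + de t *: Y
  - (eta0^-1 * h t * de t) *: L - dv t
  + (eta0^-1 * h t) *: (dv t *m B^T + B *m dv t) + (dw t + (dw t)^T)
  + (eta0^-1 ^+ 2 * ((h t - h t.-1) * (h t + h t.-1))) *: (B *m v t.-1 *m B^T)
  + (eta0^-1 * (h t - h t.-1)) *: (w t.-1 *m B^T + B *m (w t.-1)^T).
Proof.
case: t => [//|t] _.
have H1 : v t.+1 = v t + dv t.+1 by rewrite /dv addrC subrK.
have H2 : w t.+1 = w t + dw t.+1 by rewrite /dw addrC subrK.
have H3 : V t.+1 = v t.+1 + e t.+1 *: Y by rewrite /v subrK.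
have H4 : W t.+1 = w t.+1 + Y *m B^T by rewrite /w subrK.
have H := (increment_formula t%:R (e t.+1) (e t) (h t.+1) (h t)
  (v t.+1) (v t) (w t.+1) (w t) (dv t.+1) (dw t.+1) (rho t.+1) (S t) (V t.+1) (W t.+1)
  (eh t.+1 isT) (e_neq0 t.+1 isT) (v_sym _) H1 H2 H3 H4 (dvE t.+1 isT) (dwE t.+1 isT) (erefl _)).
refine (eq_trans _ H).
by rewrite /Z /D /S covzS// natr1.
Qed.

Let powO_h : powO alpha h.
Proof. exact: powO_powR. Qed.

Let powO_h' : powO alpha (fun t => h t.-1).
Proof. exact: (powO_pred _ _ powO_h). Qed.

Let powO_dh : powO (alpha - 1) (fun t => h t - h t.-1).
Proof.
apply: (eq_powO _ _ (fun t => - (h t.-1 - h t))); first by move=> t _; rewrite opprB.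
by apply: powON; exact: powO_diff.
Qed.

(* Since h = eta0 / e, both terms are expressed by de, up to second order in de. *)
Let powO_Xcoef : powO (alpha - 2)
  (fun t => eta0^-1 * h t ^+ 2 * de t - (h t - h t.-1)).
Proof.
have [K HK] : powO (alpha - 2)
    (fun t => eta0^-1 ^+ 2 * (de t * de t * (h t * h t) * h t.-1)).
  apply: powOMl; have -> : alpha - 2 = - alpha - 1 + (- alpha - 1) + (alpha + alpha) + alpha by ring.
  by apply: powOM => //; apply: powOM; apply: powOM.
(* The index starts at 2 because [e 0 = 0], so h = eta0 / e fails at index 0. *)
apply: (@powO_eventually _ _ _ 2 K) => t t2 t0.
rewrite (_ : _ - _ = eta0^-1 ^+ 2 * (de t * de t * (h t * h t) * h t.-1)); first exact: HK.
have t1 : (0 < t.-1)%N by rewrite -ltnS prednK.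
have := eh _ t0; have := eh _ t1; rewrite /de.
have := e_neq0 _ t0; have := e_neq0 _ t1.
move: (e t) (e t.-1) (h t) (h t.-1) => x y p q y0 x0 E1 E2.
have -> : q = eta0 / y by rewrite -E1 mulrC mulKf.
have -> : p = eta0 / x by rewrite -E2 mulrC mulKf.
by field; rewrite x0 y0 gt_eqF.
Qed.

(** The last two terms have exactly order 2 alpha - 2. That alpha > 1/2 serves twice: the increments
    [dw] of order -1 fit into this order, and the order exceeds -1, so summation raises it by
    one. *)
Let powO_Z : powOmx (2 * alpha - 1) Z.
Proof.
have [a1 a2] := andP alpha_bounds.
have -> : 2 * alpha - 1 = 2 * alpha - 2 + 1 by ring.
apply: powOmx_increments; first lra.
have vp := powOmx_pred _ _ _ _ powO_v.
have wp := powOmx_pred _ _ _ _ powO_w.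
apply: eq_powOmx ZS _.
apply: powOmxD; first apply: powOmxD; first apply: powOmxD; first apply: powOmxD;
  first apply: powOmxB; first apply: powOmxB; first apply: powOmxD.
- by apply: (@powOmx_le _ _ _ (alpha - 2)); [lra|exact: powOmxZc].
- by apply: (@powOmx_le _ _ _ (- alpha - 1)); [lra|exact: powOmxZc].
- apply: (@powOmx_le _ _ _ (alpha + (- alpha - 1))); first lra.
  by apply: powOmxZc; apply: powOM => //; exact: powOMl.
- by apply: (@powOmx_le _ _ _ (- alpha - 1)); [lra|].
- apply: (@powOmx_le _ _ _ (alpha + (- alpha - 1))); first lra.
  apply: powOmxZ; first exact: powOMl.
  by apply: powOmxD; [exact: powOmx_mulr|exact: powOmx_mull].
- apply: (@powOmx_le _ _ _ (- 1)); first lra.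
  by apply: powOmxD => //; exact: powOmx_tr.
- apply: (@powOmx_le _ _ _ (alpha - 1 + alpha + -1)); first lra.
  apply: powOmxZ; last by apply: powOmx_mulr; exact: powOmx_mull.
  by apply: powOMl; apply: powOM => //; exact: powOD.
- apply: (@powOmx_le _ _ _ (alpha - 1 + (alpha - 1))); first lra.
  apply: powOmxZ; first exact: powOMl.
  by apply: powOmxD; [exact: powOmx_mulr|apply: powOmx_mull; exact: powOmx_tr].
Qed.

Lemma covz_expansion : powOmx (2 * alpha - 1)
  (fun T => covz A G eta0 alpha T - T%:R *: (B *m G *m B^T)
     - T%:R `^ alpha *: (eta0^-1 *: (B *m Y *m B^T))).
Proof.
have [a1 a2] := andP alpha_bounds.
apply: (eq_powOmx _ _ _ _ (fun t => Z t
    - (eta0^-1 ^+ 2 * h t ^+ 2) *: (B *m v t *m B^T)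
    - (eta0^-1 * h t) *: (w t *m B^T + B *m (w t)^T))) => [t _|].
  have aux (x a b : 'M[R]_d) : x = x + a + b - a - b by rewrite addrAC !addrK.
  exact: aux.
apply: powOmxB; first apply: powOmxB => //.
- apply: (@powOmx_le _ _ _ (alpha + alpha + -1)); first lra.
  apply: powOmxZ; last by apply: powOmx_mulr; exact: powOmx_mull.
  by apply: powOMl; exact: powOM.
- apply: (@powOmx_le _ _ _ (alpha + (alpha - 1))); first lra.
  apply: powOmxZ; first exact: powOMl.
  by apply: powOmxD; [exact: powOmx_mulr|apply: powOmx_mull; exact: powOmx_tr].
Qed.

End Asymptotics.

(** * Second moments of rewards with values in [0, 1] *)

Section RewardMoments.
Context {R : realType}.
Variable nu : probability R R.
Hypothesis nu01 : nu [set x : R | 0 <= x <= 1]%classic = 1%E.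

(** The integrand may be unbounded on the line, but it is bounded on [0, 1], whose complement is
    negligible. *)
Lemma integrable_affine_mul (a b p q : R) :
  nu.-integrable setT (EFin \o (fun x => (a - x * b) * (p - x * q))).
Proof.
pose I := [set x : R | 0 <= x <= 1]%classic.
have IE : I = `[0, 1]%classic by apply/seteqP; split => x /=; rewrite in_itv.
have mI : measurable I by rewrite IE; exact: measurable_itv.
have mf : measurable_fun setT (fun x : R => (a - x * b) * (p - x * q)).
  by apply: measurable_funM; apply: measurable_funB => //; apply: measurable_funM.
have nuC : nu (~` I)%classic = 0%E.
  by rewrite probability_setC// nu01 subee.
apply/(@negligible_integrable _ _ _ nu setT (~` I)%classic) => //.
- exact: measurableC.
- exact/measurable_EFinP.
rewrite setDE setCK setTI.
apply: (@measurable_bounded_integrable _ _ _ nu) => //.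
- by rewrite (le_lt_trans (probability_le1 _ mI))// ltry.
- exact: measurable_funTS.
exists ((`|a| + `|b|) * (`|p| + `|q|)); split; first exact: num_real.
move=> M HM x /= /andP[x0 x1]; apply: le_trans (ltW HM).
have bnd (u w : R) : `|u - x * w| <= `|u| + `|w|.
  apply: le_trans (ler_normB _ _) _.
  by rewrite lerD2l normrM ger0_norm// ler_piMl.
by rewrite normrM ler_pM.
Qed.

(** Integrates 2uv <= u^2 + v^2 and -2uv <= u^2 + v^2. *)
Lemma norm_moment_le (a b p q : R) :
  `|fine (\int[nu]_x ((a - x * b) * (p - x * q))%:E)| <=
  (fine (\int[nu]_x ((a - x * b) * (a - x * b))%:E) +
   fine (\int[nu]_x ((p - x * q) * (p - x * q))%:E)) / 2.
Proof.
pose f x := (a - x * b) * (p - x * q).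
pose g x := (a - x * b) * (a - x * b).
pose k x := (p - x * q) * (p - x * q).
have If : nu.-integrable setT (EFin \o f) by exact: integrable_affine_mul.
have Ig : nu.-integrable setT (EFin \o g) by exact: integrable_affine_mul.
have Ik : nu.-integrable setT (EFin \o k) by exact: integrable_affine_mul.
have Igk : nu.-integrable setT (EFin \o (fun x => g x + k x)).
  have -> : EFin \o (fun x => g x + k x) = ((EFin \o g) \+ (EFin \o k))%E by [].
  exact: integrableD.
have IB : nu.-integrable setT (EFin \o (fun x => 2^-1 * (g x + k x))).
  have -> : EFin \o (fun x => 2^-1 * (g x + k x)) =
      (fun x => ((2^-1)%:E * (EFin \o (fun x => (g x + k x)%R)) x)%E) by [].
  exact: integrableZl.
have IN : nu.-integrable setT (EFin \o (fun x => -1 * f x)).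
  have -> : EFin \o (fun x => -1 * f x) = (fun x => (-1)%:E * (EFin \o f) x)%E by [].
  exact: integrableZl.
have E : (Rintegral nu setT g + Rintegral nu setT k) / 2 =
    Rintegral nu setT (fun x => 2^-1 * (g x + k x)).
  by rewrite RintegralZl// RintegralD// mulrC.
rewrite -[fine _]/(Rintegral nu setT f) -[X in _ <= X / 2]/(Rintegral nu setT g + Rintegral nu setT k) E.
rewrite ler_norml; apply/andP; split.
  rewrite lerNl -mulN1r -RintegralZl//; apply: le_Rintegral => // x _.
  by have := sqr_ge0 ((a - x * b) + (p - x * q)); rewrite /f /g /k; lra.
apply: le_Rintegral => // x _.
by have := sqr_ge0 ((a - x * b) - (p - x * q)); rewrite /f /g /k; lra.
Qed.
End RewardMoments.

(** * Entries of [Gamma], and coercivity of [Sigma] and [Amat] *)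

Section TDMatrices.
Context {R : realType} {S : finType} {d : nat}.
Variables (gamma : R) (P : S -> S -> R) (mu : S -> R) (phi : S -> 'cV[R]_d).
Hypotheses (gamma01 : 0 <= gamma < 1) (P_ge0 : forall s s', 0 <= P s s').
Hypotheses (mu_ge0 : forall s, 0 <= mu s).
Local Notation A := (Amat gamma P mu phi).

Let gvec_mul th s s' x i j :
  (gvec gamma phi th s s' x *m (gvec gamma phi th s s' x)^T) i j =
  ((Amat_t gamma phi s s' *m th) i 0 - x * phi s i 0) *
  ((Amat_t gamma phi s s' *m th) j 0 - x * phi s j 0).
Proof. by rewrite mxE big_ord1 [_^T _ _]mxE /gvec !mxE. Qed.

Lemma Gamma_sym r nu : (Gamma gamma P mu phi r nu)^T = Gamma gamma P mu phi r nu.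
Proof.
apply/matrixP => i j; rewrite !mxE; apply: eq_bigr => s _; apply: eq_bigr => s' _.
congr (_ * fine _); apply: eq_integral => x _; congr (_%:E).
by rewrite !gvec_mul mulrC.
Qed.

Lemma Gamma_entry_le r (nu : S -> S -> probability R R) i j :
  (forall s s', nu s s' [set x : R | 0 <= x <= 1]%classic = 1%E) ->
  `|Gamma gamma P mu phi r nu i j| <=
    (Gamma gamma P mu phi r nu i i + Gamma gamma P mu phi r nu j j) / 2.
Proof.
move=> nu01; rewrite !mxE -big_split /= mulr_suml.
apply: le_trans (ler_norm_sum _ _ _) _; apply: ler_sum => s _.
rewrite -big_split /= mulr_suml.
apply: le_trans (ler_norm_sum _ _ _) _; apply: ler_sum => s' _.
have m0 : 0 <= mu s * P s s' by exact: mulr_ge0.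
rewrite normrM (ger0_norm m0) -mulrDr -mulrA ler_wpM2l//.
under eq_integral do rewrite gvec_mul.
under [X in _ <= (fine X + _) / 2]eq_integral do rewrite gvec_mul.
under [X in _ <= (_ + fine X) / 2]eq_integral do rewrite gvec_mul.
exact: norm_moment_le.
Qed.

Lemma lam_min_gt0_unitmx (M : 'M[R]_d) : 0 < lam_min M -> M \in unitmx.
Proof.
move=> M0; rewrite -row_free_unit -kermx_eq0; apply/rowV0P => v /sub_kermxP vM.
apply/eqP/negPn/negP => v0.
have E0 : eigenvalue M 0 by apply/eigenvalueP; exists v; rewrite // scale0r.
(* If the eigenvalues had no infimum, [inf] would take its default value 0, which also contradicts
   positivity. *)
have [hi|hi] := pselect (has_inf [set a : R | eigenvalue M a]); last first.
  by move: M0; rewrite /lam_min inf_out// ltxx.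
by have := ge_inf hi.2 E0; rewrite leNgt => /negP; apply.
Qed.

(** The linear value function with parameter [x], evaluated at the state [s]. *)
Let z (x : 'I_d -> R) s := \sum_i x i * phi s i 0.

Let quad_sum (I : finType) (x : 'I_d -> R) (c : I -> R) (M : I -> 'M[R]_d) :
  \sum_i \sum_k x i * (\sum_s c s *: M s) i k * x k =
  \sum_s c s * (\sum_i \sum_k x i * M s i k * x k).
Proof.
have -> : \sum_i \sum_k x i * (\sum_s c s *: M s) i k * x k =
    \sum_i \sum_k \sum_s c s * (x i * M s i k * x k).
  apply: eq_bigr => i _; apply: eq_bigr => k _.
  rewrite summxE mulr_sumr mulr_suml; apply: eq_bigr => s _.
  by rewrite mxE; ring.
under eq_bigr do rewrite exchange_big.
rewrite exchange_big /=; apply: eq_bigr => s _.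
by rewrite mulr_sumr; apply: eq_bigr => i _; rewrite mulr_sumr.
Qed.

Let quad_outer (x : 'I_d -> R) (a b : 'cV[R]_d) :
  \sum_i \sum_k x i * (a *m b^T) i k * x k =
  (\sum_i x i * a i 0) * (\sum_k x k * b k 0).
Proof.
rewrite mulr_suml; apply: eq_bigr => i _; rewrite mulr_sumr.
by apply: eq_bigr => k _; rewrite mxE big_ord1 mxE; ring.
Qed.

(** Invertibility replaces diagonalisation: |x|^2 is at most [frob (invmx M)] times |M x|^2, and
    Cauchy-Schwarz weighted by [mu] gives |M x|^2 <= K x^T M x. *)
Lemma Sigma_coercive : 0 < lam_min (Sigma mu phi) ->
  exists2 c, 0 < c & coercive (Sigma mu phi) c.
Proof.
move/lam_min_gt0_unitmx; set M := Sigma mu phi => Mu.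
pose K := \sum_i \sum_s mu s * phi s i 0 ^+ 2.
have K0 : 0 <= K.
  by apply: sumr_ge0 => i _; apply: sumr_ge0 => s _; rewrite mulr_ge0 ?sqr_ge0.
have f0 := frob_ge0 _ _ (invmx M).
pose b := frob (invmx M) * K + 1.
have b0 : 0 < b by rewrite /b ltr_wpDl ?mulr_ge0.
exists b^-1; first by rewrite invr_gt0.
move=> x; rewrite ler_pdivrMl//.
pose q := \sum_s mu s * z x s ^+ 2.
have q0 : 0 <= q by apply: sumr_ge0 => s _; rewrite mulr_ge0 ?sqr_ge0.
have -> : \sum_i \sum_k x i * M i k * x k = q.
  by rewrite quad_sum; apply: eq_bigr => s _; rewrite quad_outer expr2.
pose X : 'cV[R]_d := \col_i x i.
have fX : frob X = \sum_i x i ^+ 2.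
  by apply: eq_bigr => i _; rewrite big_ord1 mxE.
have MX i : (M *m X) i 0 = \sum_s (Num.sqrt (mu s) * phi s i 0) * (Num.sqrt (mu s) * z x s).
  rewrite mxE; under eq_bigr do rewrite summxE mulr_suml.
  rewrite exchange_big; apply: eq_bigr => s _ /=.
  transitivity (mu s * phi s i 0 * z x s).
    rewrite mulr_sumr; apply: eq_bigr => k _.
    by rewrite !mxE big_ord1 !mxE; ring.
  by rewrite -{1}[mu s]sqr_sqrtr//; ring.
have fMX : frob (M *m X) <= K * q.
  rewrite /frob /K mulr_suml; apply: ler_sum => i _; rewrite big_ord1 MX.
  apply: le_trans (cauchy_schwarz_sum _ _ _) _.
  rewrite le_eqVlt; apply/orP; left; apply/eqP.
  by congr (_ * _); apply: eq_bigr => s _; rewrite exprMn sqr_sqrtr.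
rewrite -fX -[X](mulKmx Mu); apply: le_trans (frob_mulmx _ _ _ _ _) _.
apply: le_trans (ler_wpM2l f0 fMX) _; rewrite mulrA ler_wpM2r// /b; lra.
Qed.

(** The form of [A] is the mean of z(s) (z(s) - gamma z(s')). As 2 z(s) z(s') <= z(s)^2 + z(s')^2
    and s, s' have the same law by stationarity, it is at least 1 - gamma times the form of
    [Sigma]. *)
Lemma Amat_coercive : (forall s, \sum_(s' : S) P s s' = 1) ->
  (forall s', \sum_(s : S) mu s * P s s' = mu s') ->
  0 < lam_min (Sigma mu phi) -> exists2 c, 0 < c & coercive A c.
Proof.
move=> P1 muP /Sigma_coercive[c c0 Sc]; have [g0 g1] := andP gamma01.
exists ((1 - gamma) * c); first by rewrite mulr_gt0// subr_gt0.
move=> x; rewrite -mulrA.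
apply: le_trans (ler_wpM2l _ (Sc x)) _; first by rewrite subr_ge0 ltW.
rewrite quad_sum.
have -> : \sum_i \sum_k x i * A i k * x k =
    \sum_s \sum_s' mu s * P s s' * (z x s * (z x s - gamma * z x s')).
  have -> : A = \sum_(p : S * S) (mu p.1 * P p.1 p.2) *: Amat_t gamma phi p.1 p.2.
    by rewrite /Amat pair_big.
  rewrite quad_sum [RHS]pair_big /=; apply: eq_bigr => -[s s'] _ /=.
  rewrite quad_outer; congr (_ * (_ * _)); rewrite /z mulr_sumr -sumrB.
  by apply: eq_bigr => k _; rewrite !mxE; ring.
(* Over pairs of states the comparison becomes termwise, with gap gamma/2 (z(s) - z(s'))^2. [E1]
   uses the row sums of [P], [E2] stationarity. *)
have -> : (1 - gamma) * (\sum_s mu s * (\sum_i \sum_k x i * (phi s *m (phi s)^T) i k * x k)) =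
    \sum_s \sum_s' mu s * P s s' * (z x s ^+ 2 - gamma / 2 * (z x s ^+ 2 + z x s' ^+ 2)).
  have E1 : \sum_s \sum_s' mu s * P s s' * z x s ^+ 2 = \sum_s mu s * z x s ^+ 2.
    apply: eq_bigr => s _; rewrite -[in RHS](mulr1 (mu s)) -(P1 s) mulr_sumr mulr_suml.
    by [].
  have E2 : \sum_s \sum_s' mu s * P s s' * z x s' ^+ 2 = \sum_s mu s * z x s ^+ 2.
    by rewrite exchange_big; apply: eq_bigr => s _; rewrite -[in RHS]muP mulr_suml.
  transitivity ((1 - gamma / 2) * (\sum_s \sum_s' mu s * P s s' * z x s ^+ 2) -
     gamma / 2 * (\sum_s \sum_s' mu s * P s s' * z x s' ^+ 2)).
    rewrite E1 E2; under eq_bigr do rewrite quad_outer -/(z x _) -expr2.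
    by field.
  rewrite !mulr_sumr -sumrB; apply: eq_bigr => s _; rewrite !mulr_sumr -sumrB.
  by apply: eq_bigr => s' _; field.
apply: ler_sum => s _; apply: ler_sum => s' _; rewrite ler_wpM2l ?mulr_ge0//.
have := mulr_ge0 g0 (sqr_ge0 (z x s - z x s')); lra.
Qed.

End TDMatrices.

(** * Comparison of the operator norm with the entries *)

Section Opnorm.
Context {R : realType} {d : nat}.

Lemma vnorm2_frob (x : 'cV[R]_d) : vnorm2 x = Num.sqrt (frob x).
Proof. by congr Num.sqrt; apply: eq_bigr => i _; rewrite big_ord1. Qed.

Let unit_image (M : 'M[R]_d) :=
  [set vnorm2 (M *m x) | x in [set x : 'cV[R]_d | vnorm2 x <= 1]]%classic.

(** The Frobenius norm dominates the operator norm; this is also the boundedness that makes [sup] a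
    genuine supremum. *)
Let ubound_unit_image (M : 'M[R]_d) : ubound (unit_image M) (Num.sqrt (frob M)).
Proof.
move=> _ [x /= x1 <-]; rewrite vnorm2_frob ler_sqrt ?frob_ge0//.
apply: le_trans (frob_mulmx _ _ _ _ _) _; rewrite ler_piMr ?frob_ge0//.
rewrite -[frob x]sqr_sqrtr ?frob_ge0// -vnorm2_frob.
by rewrite expr_le1// sqrtr_ge0.
Qed.

Let unit_image0 (M : 'M[R]_d) : unit_image M 0.
Proof.
have v0 : vnorm2 (0 : 'cV[R]_d) = 0.
  by rewrite /vnorm2 big1 ?sqrtr0// => i _; rewrite mxE expr0n.
by exists 0 => /=; rewrite ?mulmx0 v0.
Qed.

Lemma opnorm_ge0 (M : 'M[R]_d) : 0 <= opnorm M.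
Proof.
by apply: ub_le_sup; [exists (Num.sqrt (frob M)); exact: ubound_unit_image|exact: unit_image0].
Qed.

Lemma opnorm_le (M : 'M[R]_d) (b : R) : 0 <= b -> (forall i j, `|M i j| <= b) ->
  opnorm M <= d%:R * b.
Proof.
move=> b0 Mb; apply: ge_sup; first by exists 0; exact: unit_image0.
move=> y /ubound_unit_image /le_trans; apply.
have db0 : 0 <= d%:R * b by rewrite mulr_ge0.
rewrite -[leRHS](ger0_norm db0) -sqrtr_sqr ler_sqrt ?sqr_ge0//.
apply: (@le_trans _ _ (\sum_(i < d) \sum_(j < d) b ^+ 2)).
  apply: ler_sum => i _; apply: ler_sum => j _.
  by rewrite -[M i j ^+ 2]real_normK ?num_real// ler_sqr ?nnegrE.
by rewrite !sumr_const card_ord -mulrnA -[leLHS]mulr_natl natrM exprMn expr2.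
Qed.

Lemma entry_le_opnorm (M : 'M[R]_d) i j : `|M i j| <= opnorm M.
Proof.
apply: (@le_trans _ _ (vnorm2 (M *m delta_mx j 0))).
  rewrite -colE vnorm2_frob -sqrtr_sqr ler_sqrt ?frob_ge0//.
  by have := sqr_le_frob _ _ (col j M) i 0; rewrite mxE.
apply: ub_le_sup; first by exists (Num.sqrt (frob M)); exact: ubound_unit_image.
exists (delta_mx j 0) => //=; rewrite /vnorm2 (bigD1 j)//= big1.
  by rewrite mxE !eqxx expr1n addr0 sqrtr1.
by move=> k kj; rewrite mxE (negbTE kj) expr0n.
Qed.

End Opnorm.

(* Every quantity is linear in G, and symmetric matrices are spanned by finitely
   many symmetric ones, so pointwise bounds in G are uniform. *)
Lemma LamBar_expansion_uniform {R : realType} {d : nat} (A : 'M[R]_d) (c eta0 alpha : R) :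
  0 < c -> coercive A c -> 0 < eta0 -> 1 / 2 < alpha < 1 ->
  exists2 K, 0 <= K &
  exists X : 'M[R]_d -> 'M[R]_d, forall G,
    eta0 *: (A *m X G + X G *m A^T) = invmx A *m G *m (invmx A)^T /\
    (G^T = G -> forall T i j, (0 < T)%N ->
      `|(LamBar A G eta0 alpha T - invmx A *m G *m (invmx A)^T -
         T%:R `^ (alpha - 1) *: X G) i j| <=
      K * T%:R `^ (2 * alpha - 2) * \sum_k \sum_l `|G k l|).
Proof.
move=> c0 Ac e0 a01.
have Au := coercive_unitmx _ _ _ c0 Ac.
have [Y [Ylin YE]] := lyapunov_solution _ _ _ c0 Ac.
pose B := invmx A.
pose X G := eta0^-1 *: (B *m Y G *m B^T).
pose Phi T G := LamBar A G eta0 alpha T - B *m G *m B^T - T%:R `^ (alpha - 1) *: X G.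
have Philin T : linear (Phi T).
  move=> k M N; rewrite /Phi /X Ylin.
  have -> : LamBar A (k *: M + N) eta0 alpha T =
      k *: LamBar A M eta0 alpha T + LamBar A N eta0 alpha T.
    rewrite /LamBar scalerA mulrC -scalerA -scalerDr (scaler_sumr k) -big_split.
    congr (_ *: _); apply: eq_bigr => t _ /=.
    by rewrite mulmxDr mulmxDl -scalemxAr -scalemxAl.
  rewrite !(mulmxDr, mulmxDl) -!(scalemxAr, scalemxAl).
  move: (LamBar _ _ _ _ _) (LamBar _ _ _ _ _) (B *m _ *m _) (B *m _ *m _) (B *m _ *m _) (B *m _ *m _).
  by move=> M1 M2 M3 M4 M5 M6; apply/matrixP => i j; rewrite !mxE; ring.
(* For fixed symmetric [G] this is the covariance expansion divided by T. *)
have bound G : G^T = G -> powOmx (2 * alpha - 2) (fun T => Phi T G).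
  move=> GT.
  have H := covz_expansion _ _ _ _ _ _ c0 Ac e0 a01 GT (YE G).
  have -> : 2 * alpha - 2 = -1 + (2 * alpha - 1) by ring.
  apply: eq_powOmx (powOmxZ _ _ _ _ _ _ (powO_powR (-1)) H) => t t0.
  rewrite /Phi /LamBar powR_inv1// !scalerBr !scalerA mulVf ?scale1r; last by rewrite pnatr_eq0 -lt0n.
  by rewrite powR_nat_sub1// [t%:R^-1 * _]mulrC.
(* Matrix units are symmetrised because the pointwise bound is available for symmetric matrices. *)
pose E k l : 'M[R]_d := 2^-1 *: (delta_mx k l + delta_mx l k).
have ET k l : (E k l)^T = E k l.
  by rewrite /E linearZ/= linearD/= !trmx_delta addrC.
have /choice[K HK] : forall p : ('I_d * 'I_d) * ('I_d * 'I_d), exists K,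
    forall T, (0 < T)%N -> `|Phi T (E p.1.1 p.1.2) p.2.1 p.2.2| <= K * T%:R `^ (2 * alpha - 2).
  by move=> p; exact: (bound _ (ET _ _)).
exists (\sum_p `|K p|); first exact: sumr_ge0.
exists X => G; split.
  rewrite /X -!(scalemxAl, scalemxAr) -scalerDr scalerA mulfV ?gt_eqF// scale1r.
  rewrite -[in RHS](YE G) mulmxDr mulmxDl !mulmxA mulmxV// mulVmx// !mul1mx.
  by rewrite -!mulmxA -!trmx_mul mulmxV// mulVmx// trmx1 !mulmx1 addrC.
move=> GT T i j T0; rewrite -/(Phi T G).
have GE : G = \sum_k \sum_l G k l *: E k l.
  have -> : \sum_k \sum_l G k l *: E k l =
      2^-1 *: (\sum_k \sum_l G k l *: delta_mx k l + \sum_k \sum_l G l k *: delta_mx k l).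
    rewrite [X in _ + X]exchange_big -big_split scaler_sumr; apply: eq_bigr => k _.
    rewrite -big_split scaler_sumr; apply: eq_bigr => l _ /=.
    by rewrite -scalerDr !scalerA mulrC.
  have -> : \sum_k \sum_l G l k *: delta_mx k l = G.
    rewrite [RHS]matrix_sum_delta; apply: eq_bigr => k _; apply: eq_bigr => l _.
    by rewrite -[in RHS]GT mxE.
  by rewrite -matrix_sum_delta -mulr2n -[G *+ 2]scaler_nat scalerA mulVf ?pnatr_eq0// scale1r.
pose PhiL : {linear 'M[R]_d -> 'M[R]_d} := HB.pack (Phi T) (GRing.isLinear.Build _ _ _ _ _ (Philin T)).
rewrite {1}GE -[Phi T _]/(PhiL _) linear_sum summxE.
apply: le_trans (ler_norm_sum _ _ _) _; rewrite mulr_sumr; apply: ler_sum => k _.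
rewrite linear_sum summxE.
apply: le_trans (ler_norm_sum _ _ _) _; rewrite mulr_sumr; apply: ler_sum => l _.
rewrite linearZ mxE normrM mulrC ler_wpM2r//.
apply: le_trans (HK ((k, l), (i, j)) T T0) _; rewrite ler_wpM2r ?powR_ge0//.
apply: le_trans (ler_norm _) _; rewrite (bigD1 ((k, l), (i, j)))//= lerDl.
exact: sumr_ge0.
Qed.

Theorem mainTheorem16 (R : realType) (S : finType) (d : nat) (gamma : R)
  (P : S -> S -> R) (mu : S -> R) (phi : S -> 'cV[R]_d) (alpha eta0 : R) :
  0 <= gamma < 1 ->
  (forall s s', 0 <= P s s') -> (forall s, \sum_(s' : S) P s s' = 1) ->
  (forall s, 0 <= mu s) -> \sum_(s : S) mu s = 1 ->
  (forall s', \sum_(s : S) mu s * P s s' = mu s') ->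
  (forall s, vnorm2 (phi s) <= 1) ->
  0 < lam_min (Sigma mu phi) ->
  1 / 2 < alpha < 1 ->
  0 < eta0 <= (2 * lam_max (Sigma mu phi))^-1 ->
  exists C : R,
    forall (r : S -> R) (nu : S -> S -> probability R R),
      (forall s, 0 <= r s <= 1) ->
      (forall s s', nu s s' [set x : R | 0 <= x <= 1]%classic = 1%E) ->
      (forall s, 0 < mu s -> \sum_(s' : S) P s s' * pmean (nu s s') = r s) ->
      let A := Amat gamma P mu phi in
      let G := Gamma gamma P mu phi r nu in
      let L := LamStar gamma P mu phi r nu in
      exists X : 'M[R]_d,
        eta0 *: (A *m X + X *m A^T) = L /\
        (forall Y : 'M[R]_d, eta0 *: (A *m Y + Y *m A^T) = L -> Y = X) /\
        (forall T : nat, (1 <= T)%N ->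
          let F := LamBar A G eta0 alpha T - L - (T%:R `^ (alpha - 1)) *: X in
          opnorm F <= C * T%:R `^ (2 * alpha - 2) * opnorm G /\
          \tr F <= C * T%:R `^ (2 * alpha - 2) * \tr G).
Proof.
move=> gamma01 P0 P1 mu0 mu1 muP phi1 lam0 a01 /andP[e0 _].
have [c c0 Ac] := Amat_coercive _ _ _ _ gamma01 P0 mu0 P1 muP lam0.
have [K K0 [X HX]] := LamBar_expansion_uniform _ _ _ _ c0 Ac e0 a01.
(* The operator norm costs d^3: d from entries to norm, d^2 from the entry sum of [G]. The trace
   costs d^2: d diagonal entries, d from the entry sum. The sum of both serves either bound. *)
exists (K * (d%:R ^+ 2 + d%:R ^+ 3)) => r nu _ nu01 _ A G L.
have [XE XF] := HX G.
exists (X G); split; [exact: XE|split].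
  move=> Y YE; apply/eqP; rewrite -subr_eq0; apply/eqP.
  apply: (coercive_lyapunov_inj _ _ _ _ c0 Ac).
  have E : A *m Y + Y *m A^T = A *m X G + X G *m A^T.
    by apply: (can_inj (scalerK (lt0r_neq0 e0))); rewrite YE XE.
  by rewrite mulmxBr mulmxBl addrACA -opprD E subrr.
move=> T T0 F.
have {}XF i j : `|F i j| <= K * T%:R `^ (2 * alpha - 2) * \sum_k \sum_l `|G k l|.
  by apply: XF => //; exact: Gamma_sym.
set f := T%:R `^ (2 * alpha - 2) in XF *.
have f0 : 0 <= f by exact: powR_ge0.
have Kf0 : 0 <= K * f by exact: mulr_ge0.
have Gabs k l : `|G k l| <= (G k k + G l l) / 2 by exact: Gamma_entry_le.
(* Nonnegativity of the trace makes the surplus d^3 in the constant harmless. *)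
have trG0 : 0 <= \tr G.
  by apply: sumr_ge0 => k _; apply: le_trans (normr_ge0 _) (le_trans (Gabs k k) _); lra.
have opG0 := opnorm_ge0 G.
set N := \sum_k \sum_l `|G k l| in XF.
have N0 : 0 <= N by apply: sumr_ge0 => k _; exact: sumr_ge0.
have NopG : N <= d%:R ^+ 2 * opnorm G.
  apply: (@le_trans _ _ (\sum_(k < d) \sum_(l < d) opnorm G)).
    by apply: ler_sum => k _; apply: ler_sum => l _; exact: entry_le_opnorm.
  by rewrite !sumr_const card_ord -mulrnA -[leLHS]mulr_natl natrM expr2.
have NtrG : N <= d%:R * \tr G.
  apply: (@le_trans _ _ (\sum_(k < d) \sum_(l < d) (G k k + G l l) / 2)).
    by apply: ler_sum => k _; apply: ler_sum => l _.
  have -> : \sum_(k < d) \sum_(l < d) (G k k + G l l) / 2 =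
      (\sum_(k < d) \sum_(l < d) G k k + \sum_(k < d) \sum_(l < d) G l l) / 2.
    rewrite -big_split mulr_suml; apply: eq_bigr => k _.
    by rewrite -big_split mulr_suml.
  rewrite [X in (X + _) / 2]exchange_big /= sumr_const card_ord.
  by rewrite -[_ *+ d]mulr_natl -/(\tr G) -mulr2n -[_ *+ 2]mulr_natr mulfK.
have dR0 : 0 <= d%:R :> R by [].
split.
  apply: le_trans (opnorm_le _ _ (mulr_ge0 Kf0 N0) XF) _.
  apply: (@le_trans _ _ (d%:R * (K * f * (d%:R ^+ 2 * opnorm G)))).
    by rewrite ler_wpM2l// ler_wpM2l.
  rewrite -subr_ge0.
  have -> : K * (d%:R ^+ 2 + d%:R ^+ 3) * f * opnorm G -
      d%:R * (K * f * (d%:R ^+ 2 * opnorm G)) = K * f * d%:R ^+ 2 * opnorm G by ring.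
  by rewrite !mulr_ge0.
apply: (@le_trans _ _ (d%:R * (K * f * (d%:R * \tr G)))).
  apply: (@le_trans _ _ (\sum_(i < d) K * f * N)).
    apply: ler_sum => i _; exact: le_trans (ler_norm _) (XF i i).
  by rewrite sumr_const card_ord -[_ *+ d]mulr_natl ler_wpM2l// ler_wpM2l.
rewrite -subr_ge0.
have -> : K * (d%:R ^+ 2 + d%:R ^+ 3) * f * \tr G -
    d%:R * (K * f * (d%:R * \tr G)) = K * f * d%:R ^+ 3 * \tr G by ring.
by rewrite !mulr_ge0// exprn_ge0.
Qed.
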